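(* Let $X$ be an infinite-dimensional real Banach space. The following are equivalent. (a) $X$ has the Schur property. (b) $G$-differentiability and $F$-differentiability coincide for $w^*$-lower semicontinuous, continuous convex functions on $X^*$; that is, for every such $f: X^*\to\mathbb{R}$ and every $\Lambda\in X^*$, $f$ is $G$-differentiable at $\Lambda$ if and only if $f$ is $F$-differentiable at $\Lambda$. (c) $G$-differentiability and $F$-differentiability coincide (at every point of $X^*$) for dual norms on $X^*$. (d) $H_{\mathrm{lip}} = WH_{\mathrm{lip}}$ on $X$; that is, for every Lipschitz function $f: X\to\mathbb{R}$ and every $x\in X$, $f$ is $H$-differentiable at $x$ if and only if $f$ is $WH$-differentiable at $x$.
   Context: Let $\mathcal{B}$ be a bornology on a Banach space $Z$, i.e. a family of bounded subsets of $Z$ whose union is $Z$. A function $f: Z\to\mathbb{R}$ is $\mathcal{B}$-differentiable at $z\in Z$ if there is $\Lambda\in Z^*$ such that for each $B\in\mathcal{B}$, $\frac{1}{t}\bigl[f(z+th)-f(z)-\langle\Lambda,th\rangle\bigr]\to 0$ as $t\downarrow 0$, uniformly for $h\in B$. The bornologies are $G$ (singletons; Gateaux), $H$ (norm compact sets), $WH$ (weakly compact sets), $F$ (bounded sets; Fréchet). In (b) and (c), these notions are taken on $Z=X^*$ (so derivatives lie in $X^{**}$); in (d), on $Z=X$. A dual norm on $X^*$ is a norm on $X^*$ that is the dual norm of some equivalent norm on $X$. $X$ has the Schur property if every weakly convergent sequence in $X$ is norm convergent. *)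

(* Defs.v *)
From HB Require Import structures.
From mathcomp Require Import all_boot all_order all_algebra.
From mathcomp Require Import interval_inference all_classical all_reals all_analysis.

Set Implicit Arguments.
Unset Strict Implicit.
Unset Printing Implicit Defensive.

Import Order.TTheory GRing.Theory Num.Theory.
Import numFieldTopology.Exports numFieldNormedType.Exports.

Local Open Scope classical_set_scope.
Local Open Scope ring_scope.

Section dual_lmodule.
Context {R : realType} (X : normedModType R).

Definition dual_pred : {pred X -> R^o} :=
  [pred l | `[< linear l /\ continuous l >]].

Record dual_space := DualSpace
  { dual_fun :> X -> R^o ; _ : dual_fun \in dual_pred }.

HB.instance Definition _ := [isSub for dual_fun].
HB.instance Definition _ := [Choice of dual_space by <:].

Lemma dual_pred_submod_closed : submod_closed dual_pred.
Proof.
split=> [|a f g /asboolP[lf cf] /asboolP[lg cg]]; apply/asboolP; split.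
- by move=> a x y; rewrite /GRing.zero /= scaler0 addr0.
- by move=> x; exact: cst_continuous.
- move=> b x y; rewrite !fctE lf lg !scalerDr !scalerA (mulrC a b) -!addrA.
  by congr (_ + _); rewrite addrCA.
- move=> x; apply: (@continuousD R R^o X); last exact: cg.
  exact/continuousZl_tmp/cf.
Qed.

HB.instance Definition _ :=
  GRing.isSubmodClosed.Build R (X -> R^o) dual_pred dual_pred_submod_closed.
HB.instance Definition _ := [SubChoice_isSubLmodule of dual_space by <:].

Lemma dual_fun_linear (l : dual_space) : linear l.
Proof. by case: l => l /= /asboolP[]. Qed.

Lemma dual_fun_continuous (l : dual_space) : continuous l.
Proof. by case: l => l /= /asboolP[]. Qed.

HB.instance Definition _ (l : dual_space) :=
  GRing.isLinear.Build R X R^o _ (dual_fun l) (dual_fun_linear l).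

End dual_lmodule.

(* The norm dual to a norm [p] on [X]. *)
Definition dual_norm {R : realType} {X : normedModType R} (p : X -> R)
    (l : dual_space X) : R :=
  sup [set `|l x| | x in [set x | p x <= 1]].

Section dual_normed.
Context {R : realType} {X : normedModType R}.
Implicit Types l : dual_space X.

Local Notation dnorm := (dual_norm (fun x : X => `|x|)).
Local Notation values l := [set `|l x| | x in [set x : X | `|x| <= 1]].

Lemma dual_values_has_sup l : has_sup (values l).
Proof.
split; first by exists `|l 0|, 0 => //=; rewrite normr0 ler01.
have lc : bounded_near l (nbhs (0 : X)).
  exact/linear_bounded_continuous/dual_fun_continuous.
have [M hM] := (bounded_funP l).2 lc 1.
by exists M => _ [x /= x1 <-]; exact: hM.
Qed.

Lemma dual_norm_ub l x : `|l x| <= dnorm l * `|x|.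
Proof.
have [->|x0] := eqVneq x 0; first by rewrite linear0 !normr0 mulr0.
have nx : 0 < `|x| by rewrite normr_gt0.
have xE : x = `|x| *: (`|x|^-1 *: x) by rewrite scalerA divff ?gt_eqF// scale1r.
rewrite {1}xE linearZ normrM normr_id mulrC ler_wpM2r//.
apply: ub_le_sup; first by have [] := dual_values_has_sup l.
by exists (`|x|^-1 *: x) => //=; rewrite normrZ normfV normr_id mulVf ?gt_eqF.
Qed.

Lemma dual_norm_le l (M : R) :
  (forall x, `|x| <= 1 -> `|l x| <= M) -> dnorm l <= M.
Proof.
move=> lM; apply: ge_sup; first by have [] := dual_values_has_sup l.
by move=> _ [x x1 <-]; exact: lM.
Qed.

Lemma dual_norm_ge0 l : 0 <= dnorm l.
Proof.
apply: (le_trans (normr_ge0 (l 0))); apply: ub_le_sup.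
  by have [] := dual_values_has_sup l.
by exists 0 => //=; rewrite normr0 ler01.
Qed.

Lemma dual_normD l1 l2 : dnorm (l1 + l2) <= dnorm l1 + dnorm l2.
Proof.
apply: dual_norm_le => x x1; apply: (le_trans (ler_normD _ _)).
by apply: lerD; apply: (le_trans (dual_norm_ub _ _));
  rewrite ler_piMr// dual_norm_ge0.
Qed.

Lemma dual_normZ_le a l : dnorm (a *: l) <= `|a| * dnorm l.
Proof.
apply: dual_norm_le => x x1; rewrite [X in `|X|]/(a * l x) normrM ler_wpM2l//.
by apply: (le_trans (dual_norm_ub _ _)); rewrite ler_piMr// dual_norm_ge0.
Qed.

Lemma dual_normZ a l : dnorm (a *: l) = `|a| * dnorm l.
Proof.
have [->|a0] := eqVneq a 0.
  apply/eqP; rewrite eq_le dual_normZ_le normr0 mul0r.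
  exact: dual_norm_ge0.
apply/eqP; rewrite eq_le dual_normZ_le /=.
have := dual_normZ_le a^-1 (a *: l).
by rewrite scalerA mulVf// scale1r normfV ler_pdivlMl ?normr_gt0.
Qed.

Lemma dual_norm0_eq0 l : dnorm l = 0 -> l = 0.
Proof.
move=> l0; apply/val_inj/funext => x /=.
by apply/normr0_eq0/eqP; rewrite eq_le normr_ge0 (le_trans (dual_norm_ub l x))// l0 mul0r.
Qed.

HB.instance Definition _ := Lmodule_isNormed.Build R (dual_space X)
  dual_normD dual_normZ dual_norm0_eq0.

End dual_normed.

Section weak_topologies.
Context {R : realType} (X : normedModType R).

(* [X] with its weak topology: the coarsest one for which every element of
   [dual_space X] is continuous. *)
Definition weak :=
  initial_topology (fun x : X => (fun l => l x) : {ptws dual_space X -> R^o}).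
HB.instance Definition _ := Topological.on weak.

(* The dual of [X] with its weak* topology. *)
Definition weak_star :=
  initial_topology (fun l : dual_space X => (l : {ptws X -> R^o})).
HB.instance Definition _ := Topological.on weak_star.

End weak_topologies.

Section bornologies.
Context {R : realType} (Z : normedModType R).

Definition gateaux : set (set Z) := [set [set h] | h in [set: Z]].
Definition hadamard : set (set Z) := [set A | compact A].
Definition weak_hadamard : set (set Z) :=
  [set A | compact (A : set (weak Z))].
Definition frechet : set (set Z) := [set A | bounded_set A].

Definition differentiable_wrt (B : set (set Z)) (f : Z -> R) (z : Z) : Prop :=
  exists L : dual_space Z, forall A, B A ->
    {uniform A, (fun t h => t^-1 * (f (z + t *: h) - f z - L (t *: h)) : R^o)
                @ (0 : R)^'+ --> (fun=> 0)}.

End bornologies.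

Arguments gateaux {R} Z.
Arguments hadamard {R} Z.
Arguments weak_hadamard {R} Z.
Arguments frechet {R} Z.

Section norms.
Context {R : realType} {X : normedModType R}.

Definition is_norm (p : X -> R) : Prop :=
  [/\ forall x y, p (x + y) <= p x + p y,
      forall a x, p (a *: x) = `|a| * p x
    & forall x, p x = 0 -> x = 0].

Definition equivalent_norm (p : X -> R) : Prop :=
  is_norm p /\ exists c C : R,
    [/\ 0 < c, 0 < C & forall x, c * `|x| <= p x <= C * `|x|].

End norms.

Definition infinite_dimensional {R : realType} (X : normedModType R) : Prop :=
  ~ exists (n : nat) (e : 'I_n -> X),
      forall x, exists a : 'I_n -> R, x = \sum_(i < n) a i *: e i.

Definition schur_property {R : realType} (X : normedModType R) : Prop :=
  forall u : nat -> X,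
    (exists x : X, (u : nat -> weak X) @ \oo --> (x : weak X)) ->
    exists x : X, u @ \oo --> x.

(* Main.v *)
(* (a) => (b): a weak*-lower semicontinuous convex f is, up to any error, the
   supremum of affine functions given by points of X.  If f were Gateaux but not
   Frechet differentiable at l, along bad directions h n and steps t n -> 0, the
   slopes x n of almost exact affine minorants at l + t n *: h n would converge
   pointwise on X* to the Gateaux derivative.  Then (x n) is weakly Cauchy, hence
   norm Cauchy by the Schur property, which makes the convergence uniform on
   bounded sets.

   (c) => (a): given a weakly null sequence w n in ker l0 bounded away from 0 and
   x0 with l0 x0 = 1, the dual norm whose predual ball is generated by a small
   ball, x0 and the points (1 - 1/n^2)(x0 + w n) is Gateaux but not Frechet
   differentiable at l0: that ball is weakly but not strongly exposed at x0.

   (a) => (d): a bad sequence in a weakly compact set has a weakly convergent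
   subsequence (Eberlein-Smulian), which converges in norm; its range with the
   limit is norm compact.

   (d) => (a): for a weakly null sequence u n bounded away from 0, put bumps of
   height proportional to t n near t n *: u n, with t n -> 0.  The direction u n
   eventually leaves any norm compact set, but {u n} with 0 is weakly compact. *)
Require Import Defs.
From HB Require Import structures.
From mathcomp Require Import all_boot all_order all_algebra.
From mathcomp Require Import interval_inference all_classical all_reals all_analysis.
From mathcomp Require Import ring lra.

Set Implicit Arguments.
Unset Strict Implicit.
Unset Printing Implicit Defensive.

Import Order.TTheory GRing.Theory Num.Theory.
Import numFieldTopology.Exports numFieldNormedType.Exports.

Local Open Scope classical_set_scope.
Local Open Scope ring_scope.

(** * Hahn-Banach theorem through minimal sublinear functionals *)

Section hahn_banach.
Context {R : realType} {V : lmodType R}.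
Implicit Types (p q f : V -> R) (x y z : V).

Definition sublinear q :=
  (forall x y, q (x + y) <= q x + q y) /\
  (forall c x, 0 < c -> q (c *: x) <= c * q x).

Definition linear_form f :=
  (forall x y, f (x + y) = f x + f y) /\ (forall c x, f (c *: x) = c * f x).

Lemma sublinear0 q : sublinear q -> q 0 = 0.
Proof.
move=> [_ qZ]; have /(qZ _ 0) : 0 < 2^-1 :> R by rewrite invr_gt0.
have /(qZ _ 0) : 0 < 2 :> R by [].
by rewrite !scaler0; lra.
Qed.

Lemma sublinearZ q c x : sublinear q -> 0 < c -> q (c *: x) = c * q x.
Proof.
move=> [_ qZ] c0; apply/eqP; rewrite eq_le qZ//=.
have /(qZ _ (c *: x)) : 0 < c^-1 by rewrite invr_gt0.
by rewrite scalerA mulVf ?gt_eqF// scale1r ler_pdivlMl.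
Qed.

Lemma sublinearN q x : sublinear q -> - q (- x) <= q x.
Proof.
move=> qS; have [/(_ x (- x)) + _] := qS.
by rewrite subrr sublinear0//; lra.
Qed.

(** Such infima occur four times: in shaving a functional, in bounding a chain for Zorn's lemma, in
    building affine minorants and in measuring the distance to a span. *)
Lemma sublinear_inf (I : Type) (i0 : I) (F : I -> V -> R) :
  (forall x, has_lbound (range (F^~ x))) ->
  (forall i j x y, exists k, F k (x + y) <= F i x + F j y) ->
  (forall c i x, 0 < c -> exists k, F k (c *: x) <= c * F i x) ->
  sublinear (fun x => inf (range (F^~ x))).
Proof.
move=> Flb FD FZ.
have infl i x : inf (range (F^~ x)) <= F i x by apply: ge_inf => //; exists i.
have gtinf e x : 0 < e -> exists i, F i x < inf (range (F^~ x)) + e.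
  move=> e0; have [|_ [i _ <-] ?] := inf_adherent e0 (_ : has_inf (range (F^~ x))).
    by split=> //; exists (F i0 x), i0.
  by exists i.
split=> [x y|c x c0].
  apply/ler_addgt0Pr => e e0; have e20 : 0 < e / 2 by rewrite divr_gt0.
  have [i Fi] := gtinf _ x e20; have [j Fj] := gtinf _ y e20.
  have [k Fk] := FD i j x y; have := infl k (x + y).
  by move: Fi Fj Fk; lra.
rewrite -ler_pdivrMl//; apply/ler_addgt0Pr => e e0.
have [i /ltW Fi] := gtinf _ x e0; apply: le_trans Fi.
have [k Fk] := FZ c i x c0; rewrite ler_pdivrMl//.
exact: le_trans (infl k _) Fk.
Qed.

(* Subtracting the slope of [q] in the direction [z] keeps [q] sublinear and
   makes it linear along [z]. *)
Lemma sublinear_shave q z : sublinear q ->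
  exists q', [/\ sublinear q', forall x, q' x <= q x &
                 forall x, q' (x + z) <= q' x + q z /\ q' (x - z) <= q' x - q z].
Proof.
move=> qS; have [qD _] := qS.
pose F (t : {t : R | 0 <= t}) x := q (x + sval t *: z) - sval t * q z.
pose t0 : {t : R | 0 <= t} := exist _ 0 (lexx 0).
have FE (t : R) (t_ge0 : 0 <= t) x :
  F (exist _ t t_ge0) x = q (x + t *: z) - t * q z by [].
have qtz (t : R) : 0 <= t -> q (t *: z) = t * q z.
  rewrite le_eqVlt => /predU1P[<-|t_gt0]; first by rewrite scale0r mul0r sublinear0.
  exact: sublinearZ.
have Flb x : has_lbound (range (F^~ x)).
  exists (- q (- x)) => _ [[t t_ge0] _ <-]; rewrite FE.
  have := qD (- x) (x + t *: z).
  by rewrite addKr qtz//; lra.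
have infl t (t_ge0 : 0 <= t) x : inf (range (F^~ x)) <= q (x + t *: z) - t * q z.
  by apply: ge_inf => //; exists (exist _ t t_ge0).
exists (fun x => inf (range (F^~ x))); split.
- apply: (sublinear_inf t0 Flb) => [[s s0] [t t0'] x y|c [t t0'] x c0].
    exists (exist _ (s + t) (addr_ge0 s0 t0')); rewrite !FE scalerDl addrACA.
    by have := qD (x + s *: z) (y + t *: z); lra.
  exists (exist _ (c * t) (mulr_ge0 (ltW c0) t0')).
  by rewrite !FE -scalerA -scalerDr sublinearZ// mulrBr mulrA.
- by move=> x; have := infl 0 (lexx 0) x; rewrite scale0r addr0 mul0r subr0.
- move=> x; split; rewrite -lerBlDr; apply: lb_le_inf;
    try by [exists (F t0 x), t0]; move=> _ [[t t_ge0] _ <-]; rewrite FE.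
    have := infl t t_ge0 (x + z).
    have := qD (x + t *: z) z; rewrite addrAC; lra.
  (* At [x - z] the parameter [t + 1] gives back the point [x + t *: z] and subtracts one more
     [q z]. *)
  have := infl (t + 1) (addr_ge0 t_ge0 ler01) (x - z).
  by rewrite scalerDl scale1r [t *: z + z]addrC addrA subrK; lra.
Qed.

(** Shaving along [y] cannot change a minimal [q], so [q (x - y) <= q x - q y]; at [x + y] this is
    superadditivity. *)
Lemma minimal_sublinear_linear q : sublinear q ->
  (forall q', sublinear q' -> (forall x, q' x <= q x) -> q' = q) -> linear_form q.
Proof.
move=> qS qmin; have [qD _] := qS.
have qDE x y : q (x + y) = q x + q y.
  have [q' [q'S q'q q'P]] := sublinear_shave y qS.
  have {q'S q'q} q'E := qmin _ q'S q'q; rewrite q'E in q'P.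
  have := (q'P (x + y)).2; rewrite addrK => ?.
  by apply/eqP; rewrite eq_le qD /=; lra.
have qN x : q (- x) = - q x.
  by have := qDE x (- x); rewrite subrr sublinear0//; lra.
split=> // c x; have [c0|c0|->] := ltgtP c 0.
- have nc0 : 0 < - c by rewrite oppr_gt0.
  by have := sublinearZ x qS nc0; rewrite scaleNr qN; lra.
- exact: sublinearZ.
- by rewrite scale0r mul0r sublinear0.
Qed.

(** Zorn's lemma for the reversed pointwise order. A nonempty chain is bounded by its pointwise
    infimum, finite because [- p (- x)] lies below every member; the empty chain is bounded by
    [p]. *)
Lemma exists_minimal_sublinear p : sublinear p ->
  exists q, [/\ sublinear q, forall x, q x <= p x &
    forall q', sublinear q' -> (forall x, q' x <= q x) -> q' = q].
Proof.
move=> pS.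
pose T := {q : V -> R | sublinear q /\ forall x, q x <= p x}.
pose below (q r : T) := `[< forall x, sval r x <= sval q x >].
have [||||[q [qS qp]] qmin] := @Zorn T below.
- by move=> q; exact/asboolP.
- move=> q r s /asboolP qr /asboolP rs; apply/asboolP => x.
  exact: le_trans (rs x) (qr x).
- move=> [q q_] [r r_] /asboolP/= qr /asboolP/= rq; apply: eq_exist => /=.
  by apply/funext => x; apply/eqP; rewrite eq_le qr rq.
- move=> A Atot; have [[a Aa]|A0] := pselect (A !=set0); last first.
    exists (exist _ p (conj pS (fun=> lexx _))) => s As.
    by exfalso; apply: A0; exists s.
  pose F (i : {q | A q}) := sval (sval i).
  have FS i : sublinear (F i) := (svalP (sval i)).1.
  have Flb x : has_lbound (range (F^~ x)).
    exists (- p (- x)) => _ [i _ <-].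
    apply: le_trans (sublinearN x (FS i)); rewrite lerN2.
    exact: (svalP (sval i)).2.
  have infS : sublinear (fun x => inf (range (F^~ x))).
    apply: (sublinear_inf (exist _ a Aa) Flb) => [[i Ai] [j Aj] x y|c i x c0].
      have [/asboolP ij|/asboolP ji] := Atot _ _ Ai Aj.
        exists (exist _ j Aj); apply: le_trans ((FS _).1 x y) _.
        by rewrite lerD2r; exact: ij.
      exists (exist _ i Ai); apply: le_trans ((FS _).1 x y) _.
      by rewrite lerD2l; exact: ji.
    by exists i; rewrite (sublinearZ _ (FS i)).
  have infp x : inf (range (F^~ x)) <= p x.
    apply: (@le_trans _ _ (sval a x)); last exact: (svalP a).2.
    by apply: ge_inf => //; exists (exist _ a Aa).
  exists (exist (fun q => sublinear q /\ forall x, q x <= p x) _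
    (conj infS infp)) => s As; apply/asboolP => x /=.
  by apply: ge_inf => //; exists (exist _ s As).
exists q; split => // q' q'S q'q.
have q'p x : q' x <= p x := le_trans (q'q x) (qp x).
have := qmin (exist (fun q => sublinear q /\ forall x, q x <= p x) q' (conj q'S q'p)).
by move=> /(_ (introT (asboolP _) q'q)) [].
Qed.

(** Shaving along [z] first forces [f (- z) <= - p z] for every [f] below the shaved functional,
    which is the missing half of [f z = p z]. *)
Theorem hahn_banach p z : sublinear p ->
  exists f, [/\ linear_form f, forall x, f x <= p x & f z = p z].
Proof.
move=> pS; have [p' [p'S p'p p'z]] := sublinear_shave z pS.
have [f [fS fp' fmin]] := exists_minimal_sublinear p'S.
have fL := minimal_sublinear_linear fS fmin.
have fp x : f x <= p x := le_trans (fp' x) (p'p x).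
exists f; split => //; apply/eqP; rewrite eq_le fp /=.
have := (p'z 0).2; rewrite sub0r sublinear0//.
have := fp' (- z); rewrite -scaleN1r fL.2; lra.
Qed.

End hahn_banach.

(** * Elements of the dual space *)

Section dual.
Context {R : realType} {X : normedModType R}.
Implicit Types (l : dual_space X) (x : X).

Lemma dual_spaceD l1 l2 x : (l1 + l2) x = l1 x + l2 x. Proof. by []. Qed.

Lemma dual_spaceN l x : (- l) x = - l x. Proof. by []. Qed.

Lemma dual_spaceB l1 l2 x : (l1 - l2) x = l1 x - l2 x. Proof. by []. Qed.

Lemma dual_spaceZ (a : R) l x : (a *: l) x = a * l x. Proof. by []. Qed.

Lemma dual_ext l1 l2 : (forall x, l1 x = l2 x) -> l1 = l2.
Proof. by move=> l12; apply/val_inj/funext => x /=; exact: l12. Qed.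

Lemma dual_scale l (a : R) x : l (a *: x) = a * l x.
Proof. by rewrite linearZ. Qed.

Lemma dual_space_ub l x : `|l x| <= `|l| * `|x|.
Proof. exact: dual_norm_ub. Qed.

Lemma dual_space_norm_le l (M : R) :
  (forall x, `|x| <= 1 -> `|l x| <= M) -> `|l| <= M.
Proof. exact: dual_norm_le. Qed.

Lemma linear_form_dual (f : X -> R) (C : R) : linear_form f ->
  (forall x, `|f x| <= C * `|x|) -> exists l, forall x, l x = f x.
Proof.
move=> [fD fZ] fC.
have fl : linear (f : X -> R^o) by move=> a x y; rewrite fD fZ.
pose fL : {linear X -> R^o} :=
  HB.pack (f : X -> R^o) (GRing.isLinear.Build R X R^o _ (f : X -> R^o) fl).
have fc : continuous (f : X -> R^o).
  apply/(linear_bounded_continuous fL).1; apply/bounded_funP => r.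
  exists (`|C| * r) => x xr; apply: (le_trans (fC x)).
  apply: le_trans (ler_wpM2r (normr_ge0 x) (ler_norm C)) _.
  by rewrite ler_wpM2l.
have fP : (f : X -> R^o) \in @dual_pred R X by apply/asboolP.
by exists (DualSpace fP).
Qed.

End dual.

(** * Evaluation and norming functionals *)

Section functionals.
Context {R : realType} {X : normedModType R}.
Implicit Types (l : dual_space X) (x : X).

Lemma bidual_embedding x :
  exists L : dual_space (dual_space X), forall l, L l = l x.
Proof.
apply: (@linear_form_dual _ _ (fun l => l x) `|x|) => [|l].
  by split=> *; rewrite ?dual_spaceD ?dual_spaceZ.
by rewrite mulrC dual_space_ub.
Qed.

(** Symmetry of [p] turns the one-sided Hahn-Banach bound into a bound on [|l x|]. Used with the
    norm and with the distance to a span. *)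
Lemma seminorm_dominated (p : X -> R) z : sublinear p ->
  (forall x, p (- x) = p x) -> (forall x, p x <= `|x|) ->
  exists l, [/\ `|l| <= 1, forall x, `|l x| <= p x & l z = p z].
Proof.
move=> pS pN p1; have [f [fl fp fz]] := hahn_banach z pS.
have fabs x : `|f x| <= p x.
  rewrite ler_norml fp andbT lerNl -pN; apply: le_trans (fp _).
  by rewrite -[- x]scaleN1r fl.2 mulN1r.
have [x|l lE] := linear_form_dual (C := 1) fl.
  by rewrite mul1r (le_trans (fabs x)).
exists l; split=> [|x|]; rewrite ?lE//.
by apply: dual_space_norm_le => x x1; rewrite lE (le_trans (fabs x))// (le_trans (p1 x)).
Qed.

Lemma norming_functional z : exists l, `|l| <= 1 /\ l z = `|z|.
Proof.
have [||//|l [l1 _ lz]] := @seminorm_dominated (fun x => `|x|) z; last by exists l.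
- split=> [x y|c x c0]; first exact: ler_normD.
  by rewrite normrZ gtr0_norm.
- by move=> x; rewrite normrN.
Qed.

End functionals.

(** * Weak and weak* convergence tested pointwise *)

Section weak_topologies.
Context {R : realType} {X : normedModType R}.

Lemma initial_cvgP (S : choiceType) (T : topologicalType) (f : S -> T)
    (F : set_system S) (s : S) : Filter F ->
  F --> (s : initial_topology f) <-> f @ F --> f s.
Proof.
move=> FF; split=> [Fs|fF].
  by move=> A fsA; apply: Fs; exact: (@initial_continuous _ _ f s A).
by move=> A [_ [[B Bo <-] Bs BA]]; apply: filterS BA (fF _ _); exact: open_nbhs_nbhs.
Qed.

Lemma weak_cvgP (F : set_system X) (x : X) : Filter F ->
  (F : set_system (weak X)) --> (x : weak X) <->
  forall l : dual_space X, l y @[y --> F] --> l x.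
Proof.
by move=> FF; rewrite initial_cvgP pointwise_cvgP.
Qed.

Lemma weak_star_cvgP (F : set_system (dual_space X)) (l : dual_space X) : Filter F ->
  (F : set_system (weak_star X)) --> (l : weak_star X) <->
  forall x, k x @[k --> F] --> l x.
Proof.
by move=> FF; rewrite initial_cvgP pointwise_cvgP.
Qed.

End weak_topologies.

(** * Epsilon-delta form of differentiability *)

Section derivatives.
Context {R : realType} {Z : normedModType R}.
Implicit Types (B : set (set Z)) (f : Z -> R) (L : dual_space Z).

(** The derivative [L] is an argument, so that derivatives for different bornologies can be
    identified through [gateaux_unique]. *)
Definition derivative_wrt B f (z : Z) L := forall A, B A -> forall e : R, 0 < e ->
  exists2 d : R, 0 < d & forall (t : R) h, 0 < t < d -> A h ->
    `|f (z + t *: h) - f z - t * L h| <= e * t.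

Lemma differentiable_wrtP B f z :
  differentiable_wrt B f z <-> exists L, derivative_wrt B f z L.
Proof.
have normE (t : R) h L : 0 < t ->
    `|t^-1 * (f (z + t *: h) - f z - L (t *: h))| =
    t^-1 * `|f (z + t *: h) - f z - t * L h|.
  by move=> t0; rewrite normrM normfV (gtr0_norm t0) dual_scale.
split=> -[L dL]; exists L => A BA.
  move=> e e0.
  have /(dL A BA) : nbhs ((fun=> 0) : {uniform` A -> R^o})
      [set h | forall y, A y -> ball (0 : R^o) e (h y)].
    apply/uniform_nbhs; exists [set xy | ball xy.1 e xy.2]; split=> //.
    by rewrite -entourage_ballE; exists e.
  move=> [d /= d0 dP]; exists d => // t h /andP[t0 td] Ah.
  have := dP t; rewrite /= sub0r normrN gtr0_norm// => /(_ td t0 h Ah).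
  rewrite -ball_normE /= sub0r normrN normE// => /ltW.
  by rewrite ler_pdivrMl// [e * t]mulrC.
move=> P /uniform_nbhs[E [+ EP]]; rewrite -entourage_ballE => -[e /= e0 eE].
have e20 : 0 < e / 2 by rewrite divr_gt0.
have [d d0 dP] := dL A BA _ e20.
exists d => //= t /=; rewrite sub0r normrN => td t0.
rewrite gtr0_norm// in td.
apply: EP => h Ah; apply: eE => /=.
rewrite -ball_normE /= sub0r normrN normE//.
rewrite (le_lt_trans (_ : _ <= e / 2))//; last by lra.
by rewrite ler_pdivrMl// [t * (e / 2)]mulrC; apply: dP => //; rewrite t0.
Qed.

Lemma derivative_wrt_sub B B' f z L : B `<=` B' ->
  derivative_wrt B' f z L -> derivative_wrt B f z L.
Proof. by move=> BB' fL A /BB'; exact: fL. Qed.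

Lemma differentiable_wrt_sub B B' f z : B `<=` B' ->
  differentiable_wrt B' f z -> differentiable_wrt B f z.
Proof.
move=> BB' /differentiable_wrtP[L fL]; apply/differentiable_wrtP; exists L.
exact: derivative_wrt_sub fL.
Qed.

Lemma gateauxP f z L : derivative_wrt (gateaux Z) f z L <->
  forall h (e : R), 0 < e -> exists2 d : R, 0 < d & forall t : R, 0 < t < d ->
    `|f (z + t *: h) - f z - t * L h| <= e * t.
Proof.
split=> fL.
  move=> h e e0; have [|d d0 dP] := fL [set h] _ e e0; first by exists h.
  by exists d => // t td; exact: dP.
move=> _ [h _ <-] e e0; have [d d0 dP] := fL h e e0.
by exists d => // t _ td ->; exact: dP.
Qed.

Lemma gateaux_unique f z L L' :
  derivative_wrt (gateaux Z) f z L -> derivative_wrt (gateaux Z) f z L' ->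
  forall h, L h = L' h.
Proof.
move=> /gateauxP fL /gateauxP fL' h; apply/eqP; rewrite -subr_eq0 -(normr_le0 (L h - L' h)).
apply/ler_addgt0Pr => e e0; rewrite add0r.
have e20 : 0 < e / 2 by rewrite divr_gt0.
have [d d0 dP] := fL h _ e20; have [d' d'0 dP'] := fL' h _ e20.
pose t := Num.min d d' / 2.
have m0 : 0 < Num.min d d' by rewrite lt_min d0.
have t0 : 0 < t by rewrite divr_gt0.
have tm : t < Num.min d d' by rewrite /t; lra.
have /andP[td td'] : (t < d) && (t < d') by rewrite -lt_min.
have := dP t; have := dP' t; rewrite t0 td td' => /(_ isT) + /(_ isT).
rewrite !ler_norml => /andP[A1 A2] /andP[B1 B2].
by apply/andP; split; rewrite -(ler_pM2l t0); lra.
Qed.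

Lemma gateaux_sub_frechet : gateaux Z `<=` frechet Z.
Proof.
by move=> _ [h _ <-]; exists `|h|; split=> // M hM _ /= ->; exact: ltW.
Qed.

Lemma frechet_gateaux f z : differentiable_wrt (frechet Z) f z ->
  differentiable_wrt (gateaux Z) f z.
Proof. exact/differentiable_wrt_sub/gateaux_sub_frechet. Qed.

Lemma bounded_setP (A : set Z) : bounded_set A ->
  exists2 M : R, 0 < M & forall h, A h -> `|h| <= M.
Proof.
move=> [M [_ MA]]; exists (`|M| + 1); first by rewrite ltr_pwDr.
by move=> h Ah; apply: (MA (`|M| + 1)) => //; rewrite (le_lt_trans (ler_norm M))// ltrDl.
Qed.

End derivatives.

(** * Norm convergent sequences and vanishing steps *)

Lemma cvg_seqP (R : realType) (V : normedModType R) (u : nat -> V) (a : V) :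
  u @ \oo --> a <-> forall e : R, 0 < e -> exists N, forall n, (N <= n)%N -> `|u n - a| <= e.
Proof.
rewrite cvgrPdist_le; split=> ua e e0.
  have [N _ NP] := ua e e0; exists N => n Nn; rewrite distrC; exact: NP.
by have [N NP] := ua e e0; exists N => // n /= Nn; rewrite distrC; exact: NP.
Qed.

Lemma invS_small (R : realType) (a : R) : 0 < a ->
  exists N, forall n, (N <= n)%N -> n.+1%:R^-1 <= a.
Proof.
move=> a0; have /(@cvg_seqP R R^o)/(_ a a0)[N NP] := @cvg_harmonic R.
by exists N => n /NP; rewrite subr0 /harmonic ger0_norm ?invr_ge0.
Qed.

(** Turns a failure of uniform differentiability into sequences of bad steps and directions, to
    which weak convergence arguments apply. *)
Lemma vanishing_steps (R : realType) (T : Type) (A : set T) (P : R -> T -> Prop) :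
  (forall d, 0 < d -> exists t h, [/\ 0 < t < d, A h & P t h]) ->
  exists (t : nat -> R) (h : nat -> T), forall n,
    [/\ 0 < t n, t n < n.+1%:R^-1, A (h n) & P (t n) (h n)].
Proof.
move=> ex; have /choice[i iP] : forall n : nat, exists i : R * T,
    [/\ 0 < i.1, i.1 < n.+1%:R^-1, A i.2 & P i.1 i.2].
  move=> n; have [|t [h [/andP[t0 tn] Ah Pth]]] := ex n.+1%:R^-1.
    by rewrite invr_gt0.
  by exists (t, h).
by exists (fst \o i), (snd \o i).
Qed.

(** * Affine minorants given by points of X *)

Section affine_minorants.
Context {R : realType} {X : normedModType R}.
Local Notation dual := (dual_space X).
Implicit Types (l k : dual) (x y : X) (s : seq X).

(** The sets of functionals agreeing with [l] on a finite list generate a filter that converges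
    weak* to [l], so every weak* neighbourhood contains one of them. *)
Lemma weak_star_nbhs_seq (l : dual) (V : set (weak_star X)) :
  nbhs (l : weak_star X) V ->
  exists s, forall k, {in s, forall x, k x = l x} -> V k.
Proof.
pose F := filter_from [set: seq X] (fun s => [set k : dual | {in s, forall x, k x = l x}]).
have FF : Filter F.
  apply: filter_from_filter => [|s1 s2 _ _]; first by exists [::].
  by exists (s1 ++ s2) => // k ks; split=> x xs; apply: ks; rewrite mem_cat xs ?orbT.
have /[apply] : (F : set_system (weak_star X)) --> (l : weak_star X).
  apply/weak_star_cvgP => x U /nbhs_singleton lU.
  by exists [:: x] => // k kx; rewrite /= kx// mem_head.
by move=> [s _ sV]; exists s.
Qed.

(** Induction on the list: if some [k1] kills the tail but not [y], subtracting a multiple of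
    evaluation at [y] reduces to the tail; otherwise [phi] already vanishes on the kernel of the
    tail. *)
Lemma vanishing_on_kernels (phi : dual -> R) s : linear_form phi ->
  (forall k, {in s, forall x, k x = 0} -> phi k = 0) ->
  exists x, forall k, phi k = k x.
Proof.
elim: s phi => [|y s IH] phi [phiD phiZ] phi0.
  by exists 0 => k; rewrite linear0 phi0.
have [[k1 [k1s k1y]]|nk1] :=
    pselect (exists k1, {in s, forall x, k1 x = 0} /\ k1 y != 0); last first.
  apply: IH => // k ks; apply: phi0 => x; rewrite inE => /predU1P[->|]; last exact: ks.
  by apply/eqP/negP => /negP ky; apply: nk1; exists k.
have phiN k : phi (- k) = - phi k by rewrite -scaleN1r phiZ mulN1r.
(* With this [c], the form [phi - c * (evaluation at y)] vanishes at [k1]. *)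
pose c := phi k1 / k1 y.
have [||x xP] := IH (fun k => phi k - c * k y).
- split=> [k k'|a k]; first by rewrite phiD dual_spaceD mulrDr; ring.
  by rewrite phiZ dual_spaceZ; ring.
- move=> k ks; pose k' := k - (k y / k1 y) *: k1.
  have : phi k' = 0.
    apply: phi0 => x; rewrite inE dual_spaceB dual_spaceZ => /predU1P[->|xs].
      by rewrite divfK// subrr.
    by rewrite (ks _ xs) (k1s _ xs) mulr0 subrr.
  by rewrite /k' phiD phiN phiZ => k'0; rewrite -[RHS]k'0 /c; congr (_ - _); ring.
by exists (x + c *: y) => k; rewrite linearD /= dual_scale -xP subrK.
Qed.

(** Convexity with unnormalised positive weights, so that its instances combine linearly. *)
Definition convex_on_space (f : dual -> R) := forall (t u : R) l k,
  0 < t -> 0 < u -> (t + u) * f ((t + u)^-1 *: (t *: l + u *: k)) <= t * f l + u * f k.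

Lemma convex_function_on_space (f : dual -> R^o) :
  convex_function [set: dual] f -> convex_on_space f.
Proof.
move=> fconv t u l k t0 u0.
have tu0 : 0 < t + u by rewrite addr_gt0.
have c01 : 0 <= t / (t + u) <= 1.
  by apply/andP; split; [rewrite divr_ge0// ltW | rewrite ler_pdivrMr// mul1r lerDl ltW].
have /andP[c0 c1] := c01; set c := t / (t + u) in c01 c0 c1.
have cE : 1 - c = u / (t + u) by rewrite /c; field; rewrite gt_eqF.
have : f (c *: l + (1 - c) *: k) <= c * f l + (1 - c) * f k.
  by apply: (fconv (Itv01 c0 c1)); rewrite inE.
rewrite cE /c => fc.
have -> : (t + u)^-1 *: (t *: l + u *: k) = (t / (t + u)) *: l + (u / (t + u)) *: k.
  by rewrite scalerDr !scalerA ![_^-1 * _]mulrC.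
move: fc; rewrite -(ler_pM2l tu0) => /le_trans; apply.
by rewrite le_eqVlt; apply/orP; left; apply/eqP; field; rewrite gt_eqF.
Qed.

(** Lower semicontinuity gives [a <= f] on [l + N], with [N] the common kernel of finitely many
    points. The infimum over [t > 0] and [k] in [N] of [(f (l + t h + k) - a) / t] is sublinear in
    [h]. A linear form below it vanishes on [N], hence is evaluation at a point of X, and [t = 1],
    [k = 0] gives the minorant. *)
Lemma affine_minorant (f : dual -> R) l (a : R) : convex_on_space f ->
  lower_semicontinuous (fun l : weak_star X => (f l)%:E) ->
  a < f l -> exists x, forall k, a + (k - l) x <= f k.
Proof.
move=> fconv flsc afl.
have [V lV VP] := flsc l a ltac:(by rewrite lte_fin).
have [s sV] := weak_star_nbhs_seq lV.
pose N := [set k : dual | {in s, forall x, k x = 0}].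
have fN k : N k -> a <= f (l + k).
  move=> Nk; rewrite ltW// -lte_fin; apply/VP/sV => x xs.
  by rewrite dual_spaceD Nk// addr0.
have N0 : N 0 by move=> x _.
have NZ (c : R) k : N k -> N (c *: k) by move=> Nk x xs; rewrite dual_spaceZ Nk ?mulr0.
have ND k k' : N k -> N k' -> N (k + k').
  by move=> Nk Nk' x xs; rewrite dual_spaceD Nk ?Nk' ?addr0.
pose I := {i : R * dual | 0 < i.1 /\ N i.2}.
pose F (i : I) (h : dual) :=
  ((sval i).1)^-1 * (f (l + ((sval i).1 *: h + (sval i).2)) - a).
pose mkI (t : R) (k : dual) (t0 : 0 < t) (Nk : N k) : I :=
  exist (fun i : R * dual => 0 < i.1 /\ N i.2) (t, k) (conj t0 Nk).
have FE t k (t0 : 0 < t) (Nk : N k) h :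
  F (mkI t k t0 Nk) h = t^-1 * (f (l + (t *: h + k)) - a) by [].
have Flb h : has_lbound (range (F^~ h)).
  exists (- (f (l - h) - a)) => _ [[[t k] [/= t0 Nk]] _ <-].
  rewrite -[F _ _]/(t^-1 * (f (l + (t *: h + k)) - a)) ler_pdivlMl//.
  (* The segment from [l + (t *: h + k)] to [l - h] meets [l + N], where [f] is at least [a]. *)
  have := fconv 1 t (l + (t *: h + k)) (l - h) ltr01 t0.
  have -> : (1 + t)^-1 *: (1 *: (l + (t *: h + k)) + t *: (l - h)) =
      l + (1 + t)^-1 *: k.
    apply: dual_ext => x; rewrite !(dual_spaceD, dual_spaceZ, dual_spaceN) /=.
    by field; rewrite gt_eqF// addr_gt0.
  have := fN _ (NZ (1 + t)^-1 k Nk).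
  have t1 : 0 < 1 + t by rewrite addr_gt0.
  rewrite -(ler_pM2l t1); lra.
have pS : sublinear (fun h => inf (range (F^~ h))).
  apply: (sublinear_inf (mkI 1 0 ltr01 N0) Flb).
    move=> [[t k] [/= t0 Nk]] [[u k'] [/= u0 Nk']] x y.
    have tu0 : 0 < t + u by rewrite addr_gt0.
    (* Weights [u] and [t] equalise the coefficients of [x] and [y]; the common step is
       [t * u / (t + u)]. *)
    have r0 : 0 < t * u / (t + u) by rewrite divr_gt0// mulr_gt0.
    have Nk2 := NZ (t + u)^-1 _ (ND _ _ (NZ u _ Nk) (NZ t _ Nk')).
    exists (mkI _ _ r0 Nk2).
    have PE : (t + u)^-1 *: (u *: (l + (t *: x + k)) + t *: (l + (u *: y + k'))) =
        l + ((t * u / (t + u)) *: (x + y) + (t + u)^-1 *: (u *: k + t *: k')).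
      apply: dual_ext => z; rewrite !(dual_spaceD, dual_spaceZ, dual_spaceN) /=.
      by field; rewrite gt_eqF.
    have := fconv u t (l + (t *: x + k)) (l + (u *: y + k')) u0 t0.
    rewrite [u + t]addrC PE.
    rewrite FE -[F _ x]/(t^-1 * (f (l + (t *: x + k)) - a)).
    rewrite -[F _ y]/(u^-1 * (f (l + (u *: y + k')) - a)).
    rewrite ler_pdivrMl// => fc.
    rewrite (_ : _ * (_ + _) = (t + u)^-1 * (u * (f (l + (t *: x + k)) - a) +
      t * (f (l + (u *: y + k')) - a))); last first.
      by field; rewrite !gt_eqF.
    by rewrite ler_pdivlMl//; lra.
  move=> c [[t k] [/= t0 Nk]] x c0.
  have tc0 : 0 < t / c by rewrite divr_gt0.
  exists (mkI _ _ tc0 Nk); rewrite !FE scalerA divfK ?gt_eqF//.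
  by rewrite invfM invrK [_ * c]mulrC -mulrA.
have [phi [phiL phip _]] := hahn_banach 0 pS.
have phiF t k (t0 : 0 < t) (Nk : N k) h : phi h <= t^-1 * (f (l + (t *: h + k)) - a).
  by apply: (le_trans (phip h)); apply: ge_inf => //; exists (mkI t k t0 Nk).
have phiN k : phi (- k) = - phi k by rewrite -scaleN1r phiL.2 mulN1r.
have phi_le0 k : N k -> phi k <= 0.
  move=> Nk; apply/ler_addgt0Pr => e e0; rewrite add0r.
  have fa0 : 0 < f l - a by rewrite subr_gt0.
  (* For this step [t] and the element [- t *: k] of [N] the displacement cancels, leaving
     [phi k <= (f l - a) / t = e]. *)
  have t0 : 0 < (f l - a) / e by rewrite divr_gt0.
  have := phiF _ _ t0 (NZ (- ((f l - a) / e)) _ Nk) k.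
  rewrite scaleNr subrr addr0 invf_div mulrAC -mulrA divff ?gt_eqF// mulr1.
  done.
have [x xP] : exists x, forall k, phi k = k x.
  apply: (@vanishing_on_kernels _ s) => // k Nk.
  have := phi_le0 _ Nk; have := phi_le0 (- k); rewrite phiN.
  rewrite -scaleN1r => /(_ (NZ _ _ Nk)); lra.
exists x => k; have := phiF 1 0 ltr01 N0 (k - l).
rewrite invr1 mul1r scale1r addr0 [l + _]addrC subrK xP; lra.
Qed.

End affine_minorants.

(** * Weak limits and the Schur property *)

Section schur.
Context {R : realType} {X : normedModType R}.
Implicit Types (l : dual_space X) (u : nat -> X).

Lemma weak_seqP u (x : X) : (u : nat -> weak X) @ \oo --> (x : weak X) <->
  forall l e, 0 < e -> exists N, forall n, (N <= n)%N -> `|l (u n) - l x| <= e.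
Proof.
split=> [/weak_cvgP ux l|ux]; first exact/(@cvg_seqP R R^o)/ux.
by apply/weak_cvgP => l; apply/(@cvg_seqP R R^o)/ux.
Qed.

Lemma norm_seq_weak u (x : X) :
  u @ \oo --> x -> (u : nat -> weak X) @ \oo --> (x : weak X).
Proof.
move=> ux; apply/weak_cvgP => l A lA; apply: ux.
exact: (@dual_fun_continuous _ _ l x A lA).
Qed.

Lemma weak_limit_unique u (x y : X) :
  (u : nat -> weak X) @ \oo --> (x : weak X) ->
  (u : nat -> weak X) @ \oo --> (y : weak X) -> x = y.
Proof.
move=> /weak_cvgP ux /weak_cvgP uy; apply/eqP; rewrite -subr_eq0 -normr_eq0.
have [l [_ <-]] := norming_functional (x - y).
by rewrite linearB subr_eq0; apply/eqP; exact: (cvg_unique _ (ux l) (uy l)).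
Qed.

Lemma schur_weak_limit u (x : X) : schur_property X ->
  (u : nat -> weak X) @ \oo --> (x : weak X) -> u @ \oo --> x.
Proof.
move=> schurX ux; have [y uy] : exists y : X, u @ \oo --> y by apply: schurX; exists x.
by rewrite (weak_limit_unique ux (norm_seq_weak uy)).
Qed.

(** Otherwise differences of ever later terms would form a weakly null sequence bounded away from 0.
    The limit [phi] is a function on the dual that need not come from a point of X. *)
Lemma schur_weak_cauchy u (phi : dual_space X -> R) : schur_property X ->
  (forall l e, 0 < e -> exists N, forall n, (N <= n)%N -> `|l (u n) - phi l| <= e) ->
  forall e, 0 < e -> exists N, forall n m, (N <= n)%N -> (N <= m)%N -> `|u n - u m| <= e.
Proof.
move=> schurX uphi e e0; apply: contrapT => nC.
have /choice[i iP] : forall N, exists nm : nat * nat,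
    [/\ (N <= nm.1)%N, (N <= nm.2)%N & e < `|u nm.1 - u nm.2|].
  move=> N; apply: contrapT => nN; apply: nC; exists N => n m Nn Nm.
  by rewrite leNgt; apply/negP => enm; apply: nN; exists (n, m).
have /(schur_weak_limit schurX) :
    (fun N => u (i N).1 - u (i N).2 : weak X) @ \oo --> (0 : weak X).
  apply/weak_seqP => l a a0; have a20 : 0 < a / 2 by rewrite divr_gt0.
  have [N NP] := uphi l _ a20; exists N => n Nn.
  have [n1 n2 _] := iP n; rewrite linear0 subr0 linearB /=.
  have := NP _ (leq_trans Nn n1); have := NP _ (leq_trans Nn n2).
  rewrite !ler_norml => /andP[? ?] /andP[? ?]; apply/andP; split; lra.
move=> /cvg_seqP /(_ _ e0) [N /(_ _ (leqnn N))]; have [_ _] := iP N.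
by rewrite subr0 => /lt_le_trans /[apply]; rewrite ltxx.
Qed.

End schur.

(** * From Gateaux to Frechet for convex functions *)

Section convex_frechet.
Context {R : realType} {X : normedModType R}.
Local Notation dual := (dual_space X).

(** By convexity [f (l + h) - f l] dominates the difference quotients at steps [t < 1], whose limit
    is [phi h]. *)
Lemma convex_gateaux_subgradient (f : dual -> R) l (phi : dual_space dual) :
  convex_on_space f -> derivative_wrt (gateaux dual) f l phi ->
  forall h, phi h <= f (l + h) - f l.
Proof.
move=> fconv /gateauxP fphi h; apply/ler_addgt0Pr => e e0.
have [d d0 dP] := fphi h _ e0.
pose t := Num.min d 1 / 2.
have m0 : 0 < Num.min d 1 by rewrite lt_min d0 ltr01.
have t0 : 0 < t by rewrite divr_gt0.
have tm : t < Num.min d 1 by rewrite /t; lra.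
have /andP[td t1] : (t < d) && (t < 1) by rewrite -lt_min.
have u0 : 0 < 1 - t by rewrite subr_gt0.
have := fconv t (1 - t) (l + h) l t0 u0.
rewrite addrC subrK invr1 scale1r mul1r.
have -> : t *: (l + h) + (1 - t) *: l = l + t *: h.
  by apply: dual_ext => x; rewrite !(dual_spaceD, dual_spaceZ); ring.
have := dP t; rewrite t0 td => /(_ isT); rewrite ler_norml => /andP[A1 _] A2.
by rewrite -(ler_pM2l t0); move: A1 A2; lra.
Qed.

Lemma gateaux_frechet_convex (f : dual -> R^o) l : schur_property X ->
  lower_semicontinuous (fun l : weak_star X => (f l)%:E) ->
  continuous f -> convex_function [set: dual] f ->
  differentiable_wrt (gateaux dual) f l -> differentiable_wrt (frechet dual) f l.
Proof.
move=> schurX flsc fcont /convex_function_on_space fconv.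
move=> /differentiable_wrtP[phi fphi]; apply/differentiable_wrtP; exists phi.
have subgrad := convex_gateaux_subgradient fconv fphi.
move=> A /bounded_setP[M M0 AM] e e0; apply: contrapT => nd.
have [|t [h thP]] := @vanishing_steps _ _ A
    (fun t h => e * t < f (l + t *: h) - f l - t * phi h).
  move=> d d0; apply: contrapT => nth; apply: nd; exists d => // t h td Ah.
  rewrite leNgt; apply/negP; rewrite ger0_norm; last first.
    by have := subgrad (t *: h); rewrite dual_scale subr_ge0.
  by move=> eP; apply: nth; exists t, h.
have t0 n : 0 < t n by have [] := thP n.
have hM n : `|h n| <= M by have [_ _ /AM] := thP n.
have t_small (a : R) : 0 < a -> exists N, forall n, (N <= n)%N -> t n <= a.
  move=> /invS_small[N NP]; exists N => n Nn; have [_ tn _ _] := thP n.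
  exact: ltW (lt_le_trans tn (NP n Nn)).
have f_near (a : R) : 0 < a -> exists2 d : R, 0 < d &
    forall k, `|k| <= d -> `|f (l + k) - f l| <= a.
  move=> a0; have /(@cvgrPdist_le R R^o)/(_ a a0)/nbhs_ballP[d /= d0 dP] := fcont l.
  exists (d / 2) => [|k kd]; first by rewrite divr_gt0.
  have := dP (l + k); rewrite -ball_normE /= opprD addNKr normrN distrC; apply.
  by apply: le_lt_trans kd _; lra.
(* The minorant misses [f] at [l + t n *: h n] by half of the defect [e * t n]; its value at [l]
   then shows that the slope still exceeds [phi (h n)] by [e / 2]. *)
have /choice[x xP] : forall n, exists x, forall k,
    f (l + t n *: h n) - e / 2 * t n + (k - (l + t n *: h n)) x <= f k.
  move=> n; apply: affine_minorant => //.
  by rewrite ltrBlDr ltrDl mulr_gt0// divr_gt0.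
have hx_gt n : e / 2 < h n (x n) - phi (h n).
  have := xP n l; rewrite opprD addNKr dual_spaceN dual_spaceZ => A1.
  by have [_ _ _ A2] := thP n; rewrite -(ltr_pM2l (t0 n)); move: A1 A2; lra.
(* The minorant is evaluated further along the ray, at [l + (t n + s) *: h n], where [f] is within 1
   of [f l]; [s] is chosen so that this holds once [t n <= s]. *)
have [C C0 hxC] : exists2 C : R, 0 < C & exists N, forall n, (N <= n)%N -> h n (x n) <= C.
  have [d d0 dP] := f_near 1 ltr01.
  pose s := d / (2 * M).
  have s0 : 0 < s by rewrite divr_gt0// mulr_gt0.
  have [N NP] := t_small s s0.
  have e20 : 0 < e / 2 * s by rewrite mulr_gt0// divr_gt0.
  exists ((2 + e / 2 * s) / s); first by rewrite divr_gt0// addr_gt0.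
  exists N => n Nn; rewrite ler_pdivlMr//.
  have small r : 0 <= r <= 2 * s -> `|r *: h n| <= d.
    move=> /andP[r0 rs]; rewrite normrZ ger0_norm// (_ : d = 2 * s * M).
      exact: ler_pM.
    by rewrite /s; field; rewrite gt_eqF.
  have tns := NP n Nn; have tn0 := t0 n.
  have /dP := small (t n) ltac:(by apply/andP; split; lra).
  have /dP := small (t n + s) ltac:(by apply/andP; split; lra).
  have := xP n (l + (t n + s) *: h n).
  have -> : l + (t n + s) *: h n - (l + t n *: h n) = s *: h n.
    by apply: dual_ext => z; rewrite !(dual_spaceD, dual_spaceZ, dual_spaceN); ring.
  rewrite dual_spaceZ !ler_norml => A1 /andP[_ A2] /andP[A3 _].
  have : e / 2 * t n <= e / 2 * s by rewrite ler_pM2l// divr_gt0.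
  by move: A1 A2 A3; lra.
(* The minorant at [l + s *: k] bounds [s * k (x n)]. Of the error [a * s], half comes from the
   Gateaux derivative, a quarter from continuity of [f] at [l], and a quarter from the terms with
   factor [t n]. *)
have xphi (k : dual) (a : R) : 0 < a ->
    exists N, forall n, (N <= n)%N -> k (x n) <= phi k + a.
  move=> a0; have a20 : 0 < a / 2 by rewrite divr_gt0.
  have [d d0 dP] := (gateauxP _ _ _).1 fphi k _ a20.
  pose s := d / 2; have s0 : 0 < s by rewrite divr_gt0.
  have as0 : 0 < a * s / 4 by rewrite divr_gt0// mulr_gt0.
  have [d' d'0 d'P] := f_near _ as0.
  have eC0 : 0 < e / 2 + C by rewrite addr_gt0// divr_gt0.
  have [N1 N1P] := t_small _ (divr_gt0 as0 eC0).
  have [N2 N2P] := t_small _ (divr_gt0 d'0 M0).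
  have [N3 N3P] := hxC.
  exists (maxn N1 (maxn N2 N3)) => n; rewrite !geq_max => /and3P[N1n N2n N3n].
  have := N1P n N1n; rewrite ler_pdivlMr// => A1.
  have : `|t n *: h n| <= d'.
    rewrite normrZ gtr0_norm//; apply: le_trans (ler_wpM2l (ltW (t0 n)) (hM n)) _.
    by rewrite -ler_pdivlMr// N2P.
  move=> /d'P; rewrite ler_norml => /andP[A2 _].
  have A3 : t n * h n (x n) <= t n * C by rewrite ler_pM2l// N3P.
  have := dP s; rewrite s0 (_ : s < d); last by rewrite /s; lra.
  move=> /(_ isT); rewrite ler_norml => /andP[_ A4].
  have := xP n (l + s *: k).
  have -> : l + s *: k - (l + t n *: h n) = s *: k - t n *: h n.
    by rewrite opprD addrACA subrr add0r.
  rewrite dual_spaceB !dual_spaceZ => A5.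
  by rewrite -(ler_pM2l s0); move: A1 A2 A3 A4 A5; lra.
(* The upper bound [xphi] at [k] and at [- k] gives pointwise convergence to [phi]. *)
have [||N NP] := @schur_weak_cauchy _ _ x phi schurX _ (e / (4 * M)).
- move=> k a a0; have [N NP] := xphi k a a0; have [N' NP'] := xphi (- k) a a0.
  exists (maxn N N') => n; rewrite geq_max => /andP[Nn N'n].
  have := NP n Nn; have := NP' n N'n; rewrite dual_spaceN linearN /= ler_norml => ? ?.
  by apply/andP; split; lra.
- by rewrite divr_gt0// mulr_gt0.
(* With [h N] fixed, a later [x m] has [h N (x m) <= phi (h N) + e / 4], and replacing [x N] by
   [x m] costs at most [e / 4], against the excess [e / 2]. *)
have [N' NP'] := xphi (h N) (e / 4) ltac:(by rewrite divr_gt0).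
pose m := maxn N N'.
have A0 := NP' m (leq_maxr _ _).
have := NP N m (leqnn _) (leq_maxl _ _).
have := hx_gt N.
have := dual_space_ub (h N) (x N - x m); rewrite linearB /= ler_norml => /andP[_ A1] A2 A3.
have : `|h N| * `|x N - x m| <= M * (e / (4 * M)) by apply: ler_pM.
have -> : M * (e / (4 * M)) = e / 4 by field; rewrite gt_eqF.
by move: A0 A1 A2; lra.
Qed.

End convex_frechet.

(** * Support functions of bounded sets *)

Section support_function.
Context {R : realType} {X : normedModType R}.
Local Notation dual := (dual_space X).
Implicit Types (S : set X) (l k : dual).

(** For [S] the unit ball of [p] this is [dual_norm p] by definition. *)
Definition abs_support S l : R := sup [set `|l x| | x in S].

Context {S : set X} (S0 : S !=set0) {M : R} (SM : forall x, S x -> `|x| <= M).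

Lemma abs_support_ub l x : S x -> `|l x| <= abs_support S l.
Proof.
move=> Sx; apply: ub_le_sup; last by exists x.
exists (`|l| * M) => _ [y Sy <-]; apply: le_trans (dual_space_ub l y) _.
by rewrite ler_wpM2l// SM.
Qed.

Lemma abs_support_le l a : (forall x, S x -> `|l x| <= a) -> abs_support S l <= a.
Proof.
move=> la; apply: ge_sup => [|_ [x Sx <-]]; last exact: la.
by have [x Sx] := S0; exists `|l x|, x.
Qed.

Lemma abs_support_gt l a : a < abs_support S l -> exists2 x, S x & a < `|l x|.
Proof.
move=> /sup_gt[|_ [x Sx <-] ax]; last by exists x.
by have [x Sx] := S0; exists `|l x|, x.
Qed.

Lemma abs_supportD l k : abs_support S (l + k) <= abs_support S l + abs_support S k.
Proof.
apply: abs_support_le => x Sx; rewrite dual_spaceD.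
by apply: le_trans (ler_normD _ _) _; apply: lerD; exact: abs_support_ub.
Qed.

Lemma abs_supportZ (a : R) l : abs_support S (a *: l) <= `|a| * abs_support S l.
Proof.
apply: abs_support_le => x Sx; rewrite dual_spaceZ normrM.
by rewrite ler_wpM2l//; exact: abs_support_ub.
Qed.

Lemma abs_support_ge0 l : 0 <= abs_support S l.
Proof. by have [x Sx] := S0; exact: le_trans (normr_ge0 (l x)) (abs_support_ub _ Sx). Qed.

Lemma abs_support_le_norm l : abs_support S l <= M * `|l|.
Proof.
apply: abs_support_le => x Sx; rewrite mulrC.
by apply: le_trans (dual_space_ub _ _) _; rewrite ler_wpM2l// SM.
Qed.

Lemma abs_support_continuous : continuous (abs_support S : dual -> R^o).
Proof.
move=> l; apply/(@cvgrPdist_le R R^o _ (nbhs l) (nbhs_filter l)) => e e0.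
have M0 : 0 <= M by have [x /SM] := S0; exact: le_trans.
have M1 : 0 < M + 1 by rewrite ltr_wpDl.
apply/nbhs_ballP; exists (e / (M + 1)) => /=; first by rewrite divr_gt0.
move=> k; rewrite -ball_normE /= => lk.
have lke : M * `|l - k| <= e.
  apply: le_trans (_ : (M + 1) * (e / (M + 1)) <= _); last by rewrite mulrC divfK ?gt_eqF.
  by apply: ler_pM => //; [rewrite lerDl | exact: ltW].
have lip h h' : abs_support S h <= abs_support S h' + M * `|h - h'|.
  rewrite -{1}(subrK h' h) addrC; apply: le_trans (abs_supportD _ _) _.
  by rewrite lerD2l abs_support_le_norm.
have A1 := lip l k; have A2 := lip k l; rewrite distrC in A2.
by rewrite ler_norml; apply/andP; split; lra.
Qed.

Lemma abs_support_convex :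
  convex_function [set: dual] (abs_support S : dual -> R^o).
Proof.
move=> t l k _ _.
suff : abs_support S (t%:num *: l + (1 - t%:num) *: k) <=
  t%:num * abs_support S l + (1 - t%:num) * abs_support S k by [].
apply: le_trans (abs_supportD _ _) _; apply: lerD;
  apply: le_trans (abs_supportZ _ _) _; rewrite ger0_norm// subr_ge0.
Qed.

Lemma abs_support_lsc :
  lower_semicontinuous (fun l : weak_star X => (abs_support S l)%:E).
Proof.
move=> l a; rewrite lte_fin => /abs_support_gt[x Sx ax].
pose F : set_system dual := @nbhs _ (weak_star X) l.
have FF : Filter F := @nbhs_filter (weak_star X) l.
have xl : k x @[k --> F] --> l x by apply: (weak_star_cvgP l FF).1.
have e0 : 0 < (`|l x| - a) / 2 by rewrite divr_gt0// subr_gt0.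
have /(@cvgrPdist_le R R^o)/(_ _ e0) lV := xl.
eexists; first exact: lV.
move=> k /= kV; rewrite lte_fin; apply: lt_le_trans (abs_support_ub k Sx).
have := ler_normD (l x - k x) (k x); rewrite subrK.
by move: kV ax; lra.
Qed.

End support_function.

(** * Dual norms as convex weak* lower semicontinuous functions *)

Section equivalent_norms.
Context {R : realType} {X : normedModType R}.

Lemma equivalent_norm_ball (p : X -> R) : equivalent_norm p ->
  [set x | p x <= 1] !=set0 /\
  exists M : R, forall x, [set x | p x <= 1] x -> `|x| <= M.
Proof.
move=> [[_ pZ _] [c [C [c0 C0 cC]]]]; split.
  by exists 0; rewrite /= -(scaler0 _ 0) pZ normr0 mul0r ler01.
exists c^-1 => x /= px; have /andP[cx _] := cC x.
by rewrite -(ler_pM2l c0) divff ?gt_eqF// (le_trans cx).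
Qed.

Lemma dual_norm_gateaux_frechet :
  (forall f : dual_space X -> R^o,
    lower_semicontinuous (fun l : weak_star X => (f l)%:E) ->
    continuous f ->
    convex_function [set: dual_space X] f ->
    forall l : dual_space X,
      differentiable_wrt (gateaux (dual_space X)) f l <->
      differentiable_wrt (frechet (dual_space X)) f l) ->
  forall p : X -> R, equivalent_norm p ->
    forall l : dual_space X,
      differentiable_wrt (gateaux (dual_space X)) (dual_norm p) l <->
      differentiable_wrt (frechet (dual_space X)) (dual_norm p) l.
Proof.
move=> GF p /equivalent_norm_ball[p0 [M pM]]; apply: GF.
- exact: (abs_support_lsc p0 pM).
- exact: (abs_support_continuous p0 pM).
- exact: (abs_support_convex p0 pM).
Qed.

End equivalent_norms.

(** * Support functions as dual norms *)

Section renorming.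
Context {R : realType} {X : normedModType R}.

(* The bipolar of [S] is the unit ball of the norm [p]; taking [p] as a supremum
   over the polar of [S] avoids the bipolar theorem. *)
Lemma abs_support_dual_norm (S : set X) (M r : R) : 0 < r ->
  (forall x, `|x| <= r -> S x) -> (forall x, S x -> `|x| <= M) ->
  exists p : X -> R, equivalent_norm p /\ dual_norm p = abs_support S.
Proof.
move=> r0 rS SM.
have S0 : S !=set0 by exists 0; apply: rS; rewrite normr0 ltW.
have M0 : 0 < M + 1.
  by rewrite ltr_wpDl//; have [x /SM] := S0; exact: le_trans.
pose q := abs_support S.
have q0 l : 0 <= q l := abs_support_ge0 S0 SM l.
have rq l : r * `|l| <= q l.
  rewrite -ler_pdivlMl//; apply: dual_space_norm_le => x x1; rewrite ler_pdivlMl//.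
  have /rS /(abs_support_ub SM l) : `|r *: x| <= r by rewrite normrZ gtr0_norm// ger_pMr.
  by rewrite dual_scale normrM (gtr0_norm r0).
have qZ (a : R) l : 0 <= a -> q (a *: l) <= a * q l.
  by move=> a0; apply: le_trans (abs_supportZ S0 SM a l) _; rewrite ger0_norm.
pose P x := [set `|l x| | l in [set l | q l <= 1]].
have Plb x : has_ubound (P x).
  exists (r^-1 * `|x|) => _ [l /= ql <-]; apply: le_trans (dual_space_ub _ _) _.
  by rewrite ler_wpM2r// -(ler_pM2l r0) divff ?gt_eqF// (le_trans (rq l)).
pose p x := sup (P x).
have p_ub l x : q l <= 1 -> `|l x| <= p x by move=> ql; apply: ub_le_sup => //; exists l.
have q00 : q 0 <= 1.
  by apply: le_trans (abs_support_le_norm S0 SM 0) _; rewrite normr0 mulr0.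
have p_le x a : (forall l, q l <= 1 -> `|l x| <= a) -> p x <= a.
  move=> xa; apply: ge_sup => [|_ [l /= ql <-]]; last exact: xa.
  by exists `|(0 : dual_space X) x|, 0.
have p_ge0 x : 0 <= p x := le_trans (normr_ge0 _) (p_ub 0 x q00).
have pZ_le (a : R) x : p (a *: x) <= `|a| * p x.
  by apply: p_le => l ql; rewrite dual_scale normrM ler_wpM2l// p_ub.
(* A norming functional divided by [M + 1] lies in the polar of [S], since [q l <= M * |l|]; adding
   1 keeps the constant positive even if [M = 0]. *)
have pM x : (M + 1)^-1 * `|x| <= p x.
  have [l [l1 lx]] := norming_functional x.
  have ql : q ((M + 1)^-1 *: l) <= 1.
    apply: le_trans (qZ _ _ _) _; first by rewrite invr_ge0 ltW.
    rewrite ler_pdivrMl// mulr1; apply: le_trans (abs_support_le_norm S0 SM l) _.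
    have M_ge0 : 0 <= M by have [x' /SM] := S0; exact: le_trans.
    have : M * `|l| <= M * 1 by rewrite ler_wpM2l.
    by lra.
  have := p_ub _ x ql; rewrite dual_spaceZ lx; exact: le_trans (ler_norm _).
have pn : is_norm p.
  split=> [x y|a x|x px].
  - apply: p_le => l ql; rewrite linearD /=; apply: le_trans (ler_normD _ _) _.
    by apply: lerD; exact: p_ub.
  - have [->|a0] := eqVneq a 0.
      rewrite scale0r normr0 mul0r; apply/eqP; rewrite eq_le p_ge0 andbT.
      by apply: p_le => l _; rewrite linear0 normr0.
    apply/eqP; rewrite eq_le pZ_le /=.
    have := pZ_le a^-1 (a *: x).
    by rewrite scalerA mulVf// scale1r normfV ler_pdivlMl ?normr_gt0.
  - apply/eqP; rewrite -normr_le0 -(ler_pM2l (_ : 0 < (M + 1)^-1)) ?invr_gt0// mulr0.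
    by rewrite -px.
have peq : equivalent_norm p.
  split=> //; exists (M + 1)^-1, r^-1; split; rewrite ?invr_gt0//.
  move=> x; rewrite pM /=; apply: p_le => l ql; apply: le_trans (dual_space_ub _ _) _.
  by rewrite ler_wpM2r// -(ler_pM2l r0) divff ?gt_eqF// (le_trans (rq l)).
exists p; split=> //; apply/funext => l.
have [p0 [M' pM']] := equivalent_norm_ball peq.
(* One inequality normalises [l] into the polar of [S]; the other holds because [S] lies in the unit
   ball of [p]. *)
apply/eqP; rewrite eq_le; apply/andP; split.
  apply: (abs_support_le p0) => x /= px.
  have [ql0|ql0] := eqVneq (q l) 0.
    suff -> : l = 0 by rewrite normr0.
    by apply/eqP; rewrite -normr_le0 -(ler_pM2l r0) mulr0 -ql0.
  have ql_gt0 : 0 < q l by rewrite lt_neqAle eq_sym ql0 q0.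
  have : q ((q l)^-1 *: l) <= 1.
    by apply: le_trans (qZ _ _ _) _; rewrite ?invr_ge0// mulVf.
  move=> /(p_ub _ x); rewrite dual_spaceZ normrM normfV (gtr0_norm ql_gt0) => lx.
  by rewrite -[leRHS]mulr1 -ler_pdivrMl//; exact: le_trans px.
apply: (abs_support_le S0) => x Sx; apply: (abs_support_ub pM') => /=.
by apply: p_le => k qk; apply: le_trans _ qk; exact: (abs_support_ub SM).
Qed.

End renorming.

(** * Weakly null sequences bounded away from 0 *)

Section non_schur.
Context {R : realType} {X : normedModType R}.

Lemma not_schur : ~ schur_property X -> exists u : nat -> X,
  (u : nat -> weak X) @ \oo --> (0 : weak X) /\
  exists2 d : R, 0 < d & forall n, d <= `|u n|.
Proof.
move=> nS; have [u [x ux nu]] : exists u : nat -> X, exists2 x : X,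
    (u : nat -> weak X) @ \oo --> (x : weak X) & ~ u @ \oo --> x.
  apply: contrapT => nux; apply: nS => u [x ux]; exists x.
  by apply: contrapT => nu; apply: nux; exists u, x.
have [e e0 /choice[i iP]] : exists2 e : R, 0 < e &
    forall N, exists n, (N <= n)%N /\ e < `|u n - x|.
  apply: contrapT => ne; apply: nu; apply/cvg_seqP => e e0.
  apply: contrapT => nN; apply: ne; exists e => // N.
  apply: contrapT => nn; apply: nN; exists N => n Nn.
  by rewrite leNgt; apply/negP => enx; apply: nn; exists n.
exists (fun N => u (i N) - x); split; last first.
  by exists e => // n; have [_ /ltW] := iP n.
apply/weak_seqP => l a a0; have [N NP] := (weak_seqP _ _).1 ux l a a0.
exists N => n Nn; rewrite linear0 subr0 linearB /=.
by have [ni _] := iP n; apply: NP; exact: leq_trans ni.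
Qed.

(** Normalise the sequence to [v n], take [x0 = v 0] with a norming [l0], and project along [x0]
    onto the kernel of [l0]. As [l0 (v n)] tends to 0, the projections stay weakly null and
    eventually have norm at least 1/2. *)
Lemma not_schur_hyperplane : ~ schur_property X ->
  exists (l0 : dual_space X) (x0 : X) (w : nat -> X),
  [/\ [/\ `|l0| <= 1, `|x0| <= 1 & l0 x0 = 1], forall n, l0 (w n) = 0,
      forall n, `|w n| <= 2,
      forall (l : dual_space X) (e : R), 0 < e ->
        exists N, forall n, (N <= n)%N -> `|l (w n)| <= e &
      exists N, forall n, (N <= n)%N -> 2^-1 <= `|w n|].
Proof.
move=> /not_schur[u [u0 [d d0 ud]]].
have un0 n : 0 < `|u n| := lt_le_trans d0 (ud n).
pose v n := `|u n|^-1 *: u n.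
have v1 n : `|v n| = 1 by rewrite normrZ normfV normr_id mulVf ?gt_eqF.
have v0 (l : dual_space X) (e : R) : 0 < e ->
    exists N, forall n, (N <= n)%N -> `|l (v n)| <= e.
  move=> e0; have [N NP] := (weak_seqP u 0).1 u0 l (d * e) (mulr_gt0 d0 e0).
  exists N => n /NP; rewrite linear0 subr0 dual_scale normrM normfV normr_id => lu.
  rewrite ler_pdivrMl//; apply: le_trans lu _.
  by rewrite ler_wpM2r// ltW.
clearbody v.
have [l0 [l01 l0v]] := norming_functional (v 0%N).
rewrite v1 in l0v.
have l0_le n : `|l0 (v n)| <= 1.
  by apply: le_trans (dual_space_ub _ _) _; rewrite v1 mulr1.
exists l0, (v 0%N), (fun n => v n - l0 (v n) *: v 0%N); split.
- by rewrite v1.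
- by move=> n; rewrite linearB /= dual_scale l0v mulr1 subrr.
- move=> n; apply: le_trans (ler_normB _ _) _; rewrite normrZ !v1 mulr1.
  by have := l0_le n; lra.
- move=> l e e0; have e20 : 0 < e / 2 by rewrite divr_gt0.
  have L0 : 0 < `|l| + 1 by rewrite ltr_wpDl.
  have [N NP] := v0 l _ e20; have [N' NP'] := v0 l0 _ (divr_gt0 e20 L0).
  exists (maxn N N') => n; rewrite geq_max => /andP[/NP A1 /NP'].
  rewrite ler_pdivlMr// => A2; rewrite linearB /= dual_scale.
  apply: le_trans (ler_normB _ _) _; rewrite normrM.
  have : `|l0 (v n)| * `|l (v 0%N)| <= `|l0 (v n)| * (`|l| + 1).
    rewrite ler_wpM2l//; apply: le_trans (dual_space_ub _ _) _.
    by rewrite v1 mulr1 lerDl.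
  by move: A1 A2; lra.
- have [|N NP] := v0 l0 2^-1; first by rewrite invr_gt0.
  exists N => n /NP l0v2; have := lerB_normD (v n) (- (l0 (v n) *: v 0%N)).
  by rewrite normrN normrZ !v1; lra.
Qed.

End non_schur.

(** * A support function that is Gateaux but not Frechet differentiable *)

Section gateaux_not_frechet.
Context {R : realType} {X : normedModType R}.

Context (l0 : dual_space X) (x0 : X) (w : nat -> X).
Context (l01 : `|l0| <= 1) (x01 : `|x0| <= 1) (l0x0 : l0 x0 = 1).
Context (l0w : forall n, l0 (w n) = 0) (w2 : forall n, `|w n| <= 2).
Context (w0 : forall (l : dual_space X) (e : R), 0 < e ->
  exists N, forall n, (N <= n)%N -> `|l (w n)| <= e).
Context (w_ge : exists N, forall n, (N <= n)%N -> 2^-1 <= `|w n|).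

Let a n : R := 1 - n.+1%:R^-1 ^+ 2.

(* [l0] attains its supremum 1 over [spike_set] only at [x0], but the points
   [a n *: (x0 + w n)] of [spike_set] stay far from [x0] while the values of
   [l0] at them tend to 1 quadratically in [n.+1%:R^-1]. *)
Definition spike_set : set X :=
  [set x | `|x| <= 2^-1] `|` [set x0] `|` range (fun n => a n *: (x0 + w n)).

Let a01 n : 0 <= a n <= 1.
Proof.
rewrite /a subr_ge0 lerBlDl lerDr sqr_ge0 andbT.
by rewrite expr_le1// ?invr_ge0// invf_le1// ler1n.
Qed.

Lemma spike_set_bounded x : spike_set x -> `|x| <= 3.
Proof.
move=> [[/= x2|->]|[n _ <-]].
- by lra.
- by apply: le_trans x01 _; rewrite ler1n.
- have /andP[a0 a1] := a01 n; rewrite normrZ ger0_norm//.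
  have := ler_normD x0 (w n); have := w2 n.
  have : a n * `|x0 + w n| <= 1 * `|x0 + w n| by rewrite ler_wpM2r.
  by move: x01; lra.
Qed.

Let q := abs_support spike_set.

Let spike_set0 : spike_set !=set0. Proof. by exists x0; left; right. Qed.

Let q_ub (l : dual_space X) x : spike_set x -> `|l x| <= q l.
Proof. exact: (abs_support_ub spike_set_bounded). Qed.

Lemma spike_support_l0 : q l0 = 1.
Proof.
apply/eqP; rewrite eq_le; apply/andP; split; last first.
  by have := @q_ub l0 x0; rewrite l0x0 normr1; apply; left; right.
apply: (abs_support_le spike_set0) => x [[/= x2|->]|[n _ <-]].
- by apply: le_trans (dual_space_ub _ _) _; rewrite mulr_ile1//; lra.
- by rewrite l0x0 normr1.
- rewrite dual_scale linearD /= l0x0 l0w addr0 mulr1.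
  by have /andP[? ?] := a01 n; rewrite ger0_norm.
Qed.

(** For a fixed direction [h], late spikes add at most [e * t] because [h (w n)] is small. Each
    earlier spike, like the small ball, has a fixed gap below 1 that a small [t] cannot close. *)
Lemma spike_support_gateaux (phi : dual_space (dual_space X)) :
  (forall l, phi l = l x0) -> derivative_wrt (gateaux (dual_space X)) q l0 phi.
Proof.
move=> phiE; apply/gateauxP => h e e0; rewrite spike_support_l0 phiE.
have [N NP] := w0 h e0.
pose b := N.+1%:R^-1 ^+ 2 : R.
have b0 : 0 < b by rewrite exprn_gt0// invr_gt0.
have b1 : b <= 1 by rewrite expr_le1// ?invr_ge0// invf_le1// ler1n.
have h1 : 0 < `|h| + 1 by rewrite ltr_wpDl.
exists (b / (4 * (`|h| + 1))) => [|t /andP[t0]].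
  by rewrite divr_gt0// mulr_gt0.
rewrite ltr_pdivlMr ?mulr_gt0// => tb.
have te : 0 < e * t by rewrite mulr_gt0.
have th0 : 0 <= t * `|h| by rewrite mulr_ge0// ltW.
have th : 4 * (t * `|h|) < b by move: tb t0; lra.
have hx (c : R) x : `|x| <= c -> `|t * h x| <= t * `|h| * c.
  move=> xc; rewrite normrM gtr0_norm// -mulrA ler_pM2l//.
  by apply: le_trans (dual_space_ub _ _) _; rewrite ler_wpM2l.
have := hx _ _ x01; rewrite mulr1 ler_norml => /andP[hx0 hx0'].
rewrite ler_norml; apply/andP; split.
  suff : 1 + t * h x0 <= q (l0 + t *: h) by lra.
  apply: (@le_trans _ _ `|(l0 + t *: h) x0|); last by apply: q_ub; left; right.
  by rewrite dual_spaceD dual_spaceZ l0x0 ler_norm.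
suff : q (l0 + t *: h) <= 1 + t * h x0 + e * t by lra.
apply: (abs_support_le spike_set0) => x; rewrite dual_spaceD dual_spaceZ.
move=> [[x2|->]|[n _ <-]]; first rewrite /= in x2.
- have := hx _ _ x2; have := dual_space_ub l0 x.
  have : `|l0| * `|x| <= 1 * 2^-1 by exact: ler_pM.
  have := ler_normD (l0 x) (t * h x).
  by move: th0 th hx0 b1; lra.
- by rewrite l0x0 ger0_norm; lra.
- have /andP[a0 a1] := a01 n.
  rewrite !dual_scale !linearD /= l0x0 l0w addr0 mulrCA -mulrDr.
  rewrite normrM (ger0_norm a0) mulrDr addrA.
  have hw := hx _ _ (w2 n).
  have [Nn|nN] := leqP N n.
    have hwe : `|t * h (w n)| <= t * e.
      by rewrite normrM gtr0_norm// ler_pM2l// NP.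
    apply: (@le_trans _ _ (1 * `|1 + t * h x0 + t * h (w n)|)).
      by rewrite ler_wpM2r.
    have := ler_normD (1 + t * h x0) (t * h (w n)).
    by rewrite (ger0_norm (_ : 0 <= 1 + t * h x0)); lra.
  (* The gap [b] of the early spikes beats their gain [3 * (t * |h|)] plus the possible loss
     [t * |h|] at [x0], since [4 * (t * |h|) < b]. *)
  have ab : a n <= 1 - b.
    rewrite /a lerD2l lerN2 ler_pXn2r ?nnegrE ?invr_ge0//.
    by rewrite lef_pV2 ?posrE// ler_nat ltnW.
  have : `|1 + t * h x0 + t * h (w n)| <= 1 + 3 * (t * `|h|).
    have := ler_normD (1 + t * h x0) (t * h (w n)).
    by rewrite (ger0_norm (_ : 0 <= 1 + t * h x0)); lra.
  move=> /(ler_wpM2l a0).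
  have : a n * (1 + 3 * (t * `|h|)) <= (1 - b) * (1 + 3 * (t * `|h|)).
    by rewrite ler_wpM2r//; lra.
  have : 0 <= b * (t * `|h|) by rewrite mulr_ge0// ltW.
  by lra.
Qed.

(** At step [t = 1 / (n + 1)], in a direction norming [w n], the n-th spike gains at least [t / 2]
    over [x0] and its factor [1 - t ^ 2] costs at most [2 * t ^ 2]. *)
Lemma spike_support_not_frechet (phi : dual_space (dual_space X)) :
  (forall l, phi l = l x0) -> ~ derivative_wrt (frechet (dual_space X)) q l0 phi.
Proof.
move=> phiE phiF.
have [||d d0 dP] := phiF [set h | `|h| <= 1] _ 8^-1.
- by exists 1; split=> // M M1 h /= h1; exact: le_trans (ltW M1).
- by rewrite invr_gt0.
have [N NP] := w_ge; have [N' N'P] := invS_small d0.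
(* The bound 16 makes the loss [2 * t ^ 2] smaller than [t / 8]; the successor of [N'] gives the
   strict [t < d]. *)
pose n := maxn N (maxn N'.+1 16).
have [Nn N'n n16] : [/\ (N <= n)%N, (N' < n)%N & (16 <= n)%N].
  by rewrite /n !leq_max !leqnn !orbT.
pose t : R := n.+1%:R^-1.
have t0 : 0 < t by rewrite invr_gt0.
have t16 : t < 16^-1 by rewrite ltf_pV2 ?posrE// ltr_nat.
have td : t < d.
  apply: lt_le_trans (N'P N' (leqnn _)); rewrite ltf_pV2 ?posrE// ltr_nat.
  exact: leq_trans N'n _.
have [h [h1 hw]] := norming_functional (w n).
have := dP t h; rewrite t0 td spike_support_l0 phiE => /(_ isT h1).
have : `|(l0 + t *: h) (a n *: (x0 + w n))| <= q (l0 + t *: h).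
  by apply: q_ub; right; exists n.
have /andP[a0 a1] := a01 n.
rewrite dual_scale normrM (ger0_norm a0) dual_spaceD dual_spaceZ !linearD /= l0x0 l0w.
rewrite addr0 hw.
have hx0 : `|h x0| <= 1.
  by apply: le_trans (dual_space_ub _ _) _; exact: mulr_ile1.
move=> A1; rewrite ler_norml => /andP[_ A2].
have A3 := ler_wpM2l a0 (ler_norm (1 + t * (h x0 + `|w n|))).
have W := NP n Nn; have W2 := w2 n.
move: hx0; rewrite ler_norml => /andP[H1 H2].
have : t ^+ 2 * (1 + t * (h x0 + `|w n|)) <= t ^+ 2 * 2.
  rewrite ler_wpM2l ?sqr_ge0//.
  have : t * (h x0 + `|w n|) <= t * 3 by rewrite ler_pM2l//; lra.
  by lra.
have : t * 2^-1 <= t * `|w n| by rewrite ler_pM2l.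
have : t ^+ 2 * 2 < t * 8^-1 by rewrite expr2 -mulrA ltr_pM2l//; lra.
by move: A1 A2 A3; rewrite /a -/t; lra.
Qed.

End gateaux_not_frechet.

Lemma gateaux_frechet_dual_norm_schur (R : realType) (X : normedModType R) :
  (forall p : X -> R, equivalent_norm p ->
    forall l : dual_space X,
      differentiable_wrt (gateaux (dual_space X)) (dual_norm p) l ->
      differentiable_wrt (frechet (dual_space X)) (dual_norm p) l) ->
  schur_property X.
Proof.
move=> GF; apply: contrapT => /not_schur_hyperplane.
move=> [l0 [x0 [w [[l01 x01 l0x0] l0w w2 w0 w_ge]]]].
have [|||p [peq pE]] := @abs_support_dual_norm _ _ (spike_set x0 w) 3 2^-1.
- by rewrite invr_gt0.
- by move=> x x2; left; left.
- exact: spike_set_bounded.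
have [phi phiE] := bidual_embedding x0.
have phiG := spike_support_gateaux l01 x01 l0x0 l0w w2 w0 phiE.
have := GF p peq l0; rewrite pE => /(_ _)/differentiable_wrtP[].
  by apply/differentiable_wrtP; exists phi.
(* A Frechet derivative is also a Gateaux derivative, so it must be evaluation at [x0]. *)
move=> L LF; have LG := derivative_wrt_sub gateaux_sub_frechet LF.
apply: (spike_support_not_frechet l01 x01 l0x0 l0w w2 w_ge) LF => l.
by rewrite -phiE; exact: gateaux_unique LG phiG l.
Qed.

(** * Compact sets and convergent sequences *)

Section convergent_sequences.

(** A filter that does not cluster at [x] avoids a neighbourhood of [x], hence lives on finitely
    many terms. Stated for any topology, to serve both the norm and the weak one. *)
Lemma compact_convergent_seq (T : topologicalType) (u : nat -> T) (x : T) :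
  u @ \oo --> x -> compact (x |` range u).
Proof.
move=> ux F FF FA.
have [cx|ncx] := pselect (cluster F x); first by exists x; split=> //; left.
have [B [V [FB xV BV]]] : exists B V, [/\ F B, nbhs x V & B `&` V = set0].
  apply: contrapT => nBV; apply: ncx => B V FB xV.
  by apply: contrapT => /set0P/negP/negPn/eqP BV; apply: nBV; exists B, V.
have [N _ NV] := ux V xV.
have finA : finite_set (u @` `I_N) by exact/finite_image/finite_II.
have [|y [[n nN <-] cy]] := finite_compact finA FF.
  apply: filterS (filterI FA FB) => _ [[->|[n _ <-]] By].
    exfalso; have : (B `&` V) x by split => //; exact: nbhs_singleton.
    by rewrite BV.
  have [Nn|nN] := leqP N n; last by exists n.
  exfalso; have : (B `&` V) (u n) by split=> //; exact: NV.
  by rewrite BV.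
by exists (u n); split=> //; right; exists n.
Qed.

Context {R : realType} {X : normedModType R}.

Lemma compact_weakly_compact : hadamard X `<=` weak_hadamard X.
Proof.
move=> A cA F FF FA; have [x [Ax cx]] := cA F FF FA.
exists x; split=> // B V FB xV; apply: cx => //.
have idc : (nbhs x : set_system (weak X)) --> (x : weak X).
  by apply/(weak_cvgP x (nbhs_filter x)) => l; exact: dual_fun_continuous.
exact: idc.
Qed.

Lemma gateaux_sub_hadamard : gateaux X `<=` hadamard X.
Proof. by move=> _ [h _ <-]; exact: compact_set1. Qed.

(* The [u n] have no norm-convergent subsequence because their only candidate
   limit is 0. *)
Lemma weakly_null_far_from_compact (u : nat -> X) (d : R) (C : set X) :
  (u : nat -> weak X) @ \oo --> (0 : weak X) -> 0 < d ->
  (forall n, 8 * d <= `|u n|) -> compact C ->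
  exists N, forall n y, (N <= n)%N -> C y -> d <= `|u n - y|.
Proof.
move=> u0 d0 ud /compact_near_coveringP/(_ _ \oo
  (fun n y => d <= `|u n - y|) _) [c Cc|N _ NP]; last first.
  by exists N => n y Nn Cy; exact: (NP n Nn).
suff [N NP] : exists N, forall n, (N <= n)%N -> 2 * d <= `|u n - c|.
  exists (ball c d, [set n | (N <= n)%N]) => /=.
    by split; [exact: nbhsx_ballx | exists N].
  move=> [y n] /= [+ Nn]; rewrite -ball_normE /= => cy.
  have := ler_distD y (u n) c; rewrite [`|y - c|]distrC.
  by have := NP n Nn; lra.
(* A small [c] is far from [u n] by size. For a large [c], a functional norming [c] is eventually at
   most [2 * d] on [u n], but more than [4 * d] at [c]. *)
have [c4|c4] := leP `|c| (4 * d).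
  exists 0%N => n _; have := lerB_normD (u n) (- c); rewrite normrN.
  by have := ud n; lra.
have [g [g1 gc]] := norming_functional c.
have d2 : 0 < 2 * d by rewrite mulr_gt0.
have [N NP] := (weak_seqP u 0).1 u0 g _ d2.
exists N => n /NP; rewrite linear0 subr0 => gu.
have : `|g (u n - c)| <= `|u n - c|.
  by apply: le_trans (dual_space_ub _ _) _; rewrite ler_piMl.
rewrite linearB /= gc; have := lerB_dist `|c| (g (u n)).
by rewrite normr_id [`| `|c| - _|]distrC; lra.
Qed.

End convergent_sequences.

(** * Lipschitz bumps along a weakly null sequence *)

Section bumps.
Context {R : realType} {X : normedModType R} (u : nat -> X) (d : R).
Context (u0 : (u : nat -> weak X) @ \oo --> (0 : weak X)) (d0 : 0 < d).
Context (ud : forall n, 8 * d <= `|u n|).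

Let t n : R := n.+1%:R^-1.

(** A supremum of cones of slope 1, with 0 adjoined so that it vanishes off them. *)
Definition bumps (x : X) : R :=
  sup (0 |` range (fun n => t n * d - `|x - t n *: u n|)).

Let t_gt0 n : 0 < t n. Proof. by rewrite invr_gt0. Qed.

Let bumps_has_ubound x :
  has_ubound (0 |` range (fun n => t n * d - `|x - t n *: u n|)).
Proof.
exists d => _ [->|[n _ <-]]; first exact: ltW.
rewrite lerBlDr; apply: (@le_trans _ _ (1 * d)); last by rewrite mul1r lerDl.
by rewrite ler_pM2r// invf_le1// ler1n.
Qed.

Lemma bumps_ge0 x : 0 <= bumps x.
Proof. by apply: ub_le_sup; [exact: bumps_has_ubound | left]. Qed.

Lemma bumps_ge n x : t n * d - `|x - t n *: u n| <= bumps x.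
Proof. by apply: ub_le_sup; [exact: bumps_has_ubound | right; exists n]. Qed.

Lemma bumps_le x a : 0 <= a -> (forall n, t n * d - `|x - t n *: u n| <= a) ->
  bumps x <= a.
Proof.
move=> a0 xa; apply: ge_sup => [|_ [->//|[n _ <-]]]; last exact: xa.
by exists 0; left.
Qed.

Lemma bumps0 : bumps 0 = 0.
Proof.
apply/eqP; rewrite eq_le bumps_ge0 andbT; apply: bumps_le => // n.
rewrite sub0r normrN normrZ gtr0_norm// -mulrBr pmulr_rle0//.
by move: (ud n) d0; lra.
Qed.

Lemma bumps_lipschitz : lipschitz (bumps : X -> R^o).
Proof.
have lip x y : bumps x <= bumps y + `|x - y|.
  apply: bumps_le => [|n]; first by rewrite addr_ge0// bumps_ge0.
  have := bumps_ge n y; have := ler_distD x y (t n *: u n).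
  by rewrite [`|y - x|]distrC; lra.
exists 1; split=> // M M1 [x y] _ /=.
apply: (@le_trans _ _ `|x - y|); last by rewrite ler_peMl// ltW.
have A1 := lip x y; have A2 := lip y x; rewrite distrC in A2.
by rewrite ler_norml; apply/andP; split; lra.
Qed.

(** If the n-th cone exceeds [e * s] at [s *: h], dividing by [t n] puts [c *: h] within [d] of
    [u n], with [c = s / t n < d / e]. These points form a compact set [C], which late [u n]
    avoid. *)
Lemma bumps_hadamard : derivative_wrt (hadamard X) bumps 0 0.
Proof.
move=> K cK e e0; have [M M0 KM] := bounded_setP (compact_bounded cK).
pose C := (fun z : R^o * X => z.1 *: z.2) @` (`[0, d / e]%classic `*` K).
have cC : compact C.
  apply: continuous_compact.
    by apply: continuous_subspaceT => z; exact: scale_continuous.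
  by apply: compact_setX cK; exact: segment_compact.
have [N NC] := weakly_null_far_from_compact u0 d0 ud cC.
have dM : 0 < d / M by rewrite divr_gt0.
(* For [n < N] this bound on [s] gives [|c *: h| < d], too short to be within [d] of [u n]. *)
exists (t N * (d / M)) => [|s h /andP[s0 sN] Kh]; first by rewrite mulr_gt0.
rewrite mulr0 subr0 bumps0 subr0 add0r ger0_norm ?bumps_ge0//.
apply: bumps_le => [|n]; first by rewrite mulr_ge0// ltW.
rewrite leNgt; apply/negP => es.
have tn := t_gt0 n.
pose c := s / t n.
have c0 : 0 < c by rewrite divr_gt0.
have shE : s *: h - t n *: u n = t n *: (c *: h - u n).
  by rewrite scalerBr scalerA mulrC divfK ?gt_eqF.
have {es} : e * c < d - `|u n - c *: h|.
  rewrite -(ltr_pM2l tn); apply: le_lt_trans (_ : _ <= e * s) _.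
    by rewrite /c mulrCA [_ * (s / _)]mulrC divfK ?gt_eqF.
  by move: es; rewrite shE normrZ gtr0_norm// -mulrBr distrC.
move=> ec.
have ecd : e * c < d by have := normr_ge0 (u n - c *: h); lra.
have ucd : `|u n - c *: h| < d by have := mulr_gt0 e0 c0; lra.
have [Nn|nN] := leqP N n.
  have : d <= `|u n - c *: h|.
    apply: NC => //; exists (c, h) => //=; split=> //=.
    by rewrite in_itv/= ltW//= ler_pdivlMr// mulrC ltW.
  by rewrite leNgt ucd.
have : d <= `|c *: h|.
  by have := lerB_normD (u n) (- (c *: h)); rewrite normrN; move: (ud n) d0; lra.
rewrite normrZ gtr0_norm// leNgt => /negP; apply.
apply: (@le_lt_trans _ _ (c * M)); first by rewrite ler_pM2l// KM.
rewrite -ltr_pdivlMr// /c ltr_pdivrMr// mulrC; apply: lt_le_trans sN _.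
by rewrite ler_pM2r// lef_pV2 ?posrE// ler_nat ltnW.
Qed.

Lemma bumps_not_weak_hadamard : ~ derivative_wrt (weak_hadamard X) bumps 0 0.
Proof.
move=> bWH; have wK := compact_convergent_seq u0.
have d20 : 0 < d / 2 by rewrite divr_gt0.
have [b b0 bP] := bWH _ wK _ d20.
have [N NP] := invS_small b0.
have Ku : (0 |` range u) (u N.+1) by right; exists N.+1.
have := bP (t N.+1) (u N.+1); rewrite t_gt0 /=.
have -> : t N.+1 < b.
  by apply: lt_le_trans (NP N (leqnn _)); rewrite ltf_pV2 ?posrE// ltr_nat.
move=> /(_ isT Ku).
rewrite mulr0 subr0 bumps0 subr0 add0r ger0_norm ?bumps_ge0// leNgt => /negP; apply.
apply: lt_le_trans (bumps_ge N.+1 _); rewrite subrr normr0 subr0 mulrC ltr_pM2l//.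
by move: d0; lra.
Qed.

End bumps.

Lemma hadamard_lipschitz_schur (R : realType) (X : normedModType R) :
  (forall f : X -> R^o, lipschitz f -> forall x : X,
    differentiable_wrt (hadamard X) f x ->
    differentiable_wrt (weak_hadamard X) f x) ->
  schur_property X.
Proof.
move=> HWH; apply: contrapT => /not_schur[u [u0 [d d0 ud]]].
have d80 : 0 < d / 8 by rewrite divr_gt0.
have ud8 n : 8 * (d / 8) <= `|u n| by rewrite mulrC divfK.
have bH := bumps_hadamard u0 d80 ud8.
have := HWH _ (bumps_lipschitz u d80) 0; case/(_ _)/differentiable_wrtP.
  by apply/differentiable_wrtP; exists 0.
move=> L bL; apply: (bumps_not_weak_hadamard u0 d80 ud8).
(* Both derivatives restrict to Gateaux derivatives, so the only candidate is 0. *)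
suff -> : 0 = L by [].
apply: dual_ext => h; apply: gateaux_unique.
  exact: derivative_wrt_sub gateaux_sub_hadamard bH.
apply: derivative_wrt_sub bL => A /gateaux_sub_hadamard.
exact: compact_weakly_compact.
Qed.

(** * Weakly convergent subsequences in weakly compact sets *)

Section eberlein_smulian.
Context {R : realType} {X : normedModType R}.
Implicit Types (u : nat -> X) (x y z : X) (l : dual_space X).

Lemma near_weak x l (e : R) : 0 < e ->
  nbhs (x : weak X) [set y : X | `|l y - l x| <= e].
Proof.
move=> e0; pose F : set_system X := @nbhs _ (weak X) x.
have FF : Filter F := @nbhs_filter (weak X) x.
have lx : l y @[y --> F] --> l x by apply: (weak_cvgP x FF).1.
have /(@cvgrPdist_le R R^o)/(_ _ e0) := lx.
by apply: filterS => y; rewrite /= distrC.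
Qed.

Lemma weak_cluster_seq u y (g : nat -> dual_space X) (j N : nat) (e : R) : 0 < e ->
  cluster ((u : nat -> weak X) @ \oo) (y : weak X) ->
  exists n, (N <= n)%N /\ forall k, (k <= j)%N -> `|g k (u n) - g k y| <= e.
Proof.
move=> e0 cy; pose V := [set x : X | forall k, (k <= j)%N -> `|g k x - g k y| <= e].
have yV : nbhs (y : weak X) V.
  rewrite /V; elim: j {V} => [|j IH].
    by apply: filterS (near_weak y (g 0%N) e0) => x /= gx [].
  apply: filterS (filterI IH (near_weak y (g j.+1) e0)) => x [xj gx] k.
  by rewrite leq_eqVlt => /predU1P[->|/xj].
have uN : ((u : nat -> weak X) @ \oo) (u @` [set n | (N <= n)%N]).
  by exists N => // n /= Nn; exists n.
have [_ [[n Nn <-] Vn]] := cy _ _ uN yV.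
by exists n.
Qed.

Lemma weak_cluster_seq1 u y l (N : nat) (e : R) : 0 < e ->
  cluster ((u : nat -> weak X) @ \oo) (y : weak X) ->
  exists n, (N <= n)%N /\ `|l (u n) - l y| <= e.
Proof.
move=> e0 cy; have [n [Nn /(_ 0%N)ln]] := weak_cluster_seq (fun=> l) 0 N e0 cy.
by exists n; split=> //; exact: ln.
Qed.

Lemma rat_combinations_dense u (s : seq (R * nat)) (e : R) : 0 < e ->
  exists s' : seq (rat * nat),
    `|\sum_(c <- s) c.1 *: u c.2 - \sum_(c <- s') ratr c.1 *: u c.2| <= e.
Proof.
elim: s e => [|[a n] s IH] e e0.
  by exists [::]; rewrite !big_nil subrr normr0 ltW.
have e20 : 0 < e / 2 by rewrite divr_gt0.
have [s' s'P] := IH _ e20.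
have un0 : 0 < `|u n| + 1 by rewrite ltr_wpDl.
have eu0 : 0 < e / 2 / (`|u n| + 1) by rewrite divr_gt0.
have [r /=] : exists r : rat, a < ratr r < a + e / 2 / (`|u n| + 1).
  have [|r] := @rat_in_itvoo R a (a + e / 2 / (`|u n| + 1)); first by rewrite ltrDl.
  by rewrite in_itv; exists r.
move=> /andP[ar ra].
exists ((r, n) :: s'); rewrite !big_cons /= opprD addrACA -scalerBl.
apply: le_trans (ler_normD _ _) _; rewrite normrZ.
have : `|a - ratr r| * `|u n| <= (e / 2 / (`|u n| + 1)) * (`|u n| + 1).
  apply: ler_pM => //; last by rewrite lerDl.
  by rewrite distrC ger0_norm; lra.
by rewrite divfK ?gt_eqF//; move: s'P; lra.
Qed.

(** The first condition puts [z] in the closed span of the [u n]. Rational combinations are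
    countable and dense there, and [g] norms each of them; one near [z] has small norm when [g]
    kills [z], so [z = 0]. *)
Lemma countable_separating u : exists g : nat -> dual_space X, forall z,
  (forall l, (forall n, l (u n) = 0) -> l z = 0) -> (forall k, g k z = 0) -> z = 0.
Proof.
pose W (s : seq (R * nat)) := \sum_(c <- s) c.1 *: u c.2.
pose D (s : seq (rat * nat)) := \sum_(c <- s) ratr c.1 *: u c.2 : X.
have /choice[g gP] : forall k, exists l : dual_space X,
    `|l| <= 1 /\ l (D (odflt [::] (unpickle k))) = `|D (odflt [::] (unpickle k))|.
  by move=> k; exact: norming_functional.
exists g => z zl zg.
pose F (s : seq (R * nat)) x := `|x - W s|.
pose p x := inf (range (F^~ x)).
have Flb x : has_lbound (range (F^~ x)) by exists 0 => _ [s _ <-]; exact: normr_ge0.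
have pF s x : p x <= F s x by apply: ge_inf => //; exists s.
have WZ (a : R) s : W [seq (a * c.1, c.2) | c <- s] = a *: W s.
  by rewrite /W big_map scaler_sumr; apply: eq_bigr => c _; rewrite scalerA.
have pS : sublinear p.
  apply: (sublinear_inf [::] Flb) => [s s' x y|a s x a0].
    exists (s ++ s'); rewrite /F /W big_cat /= opprD addrACA; exact: ler_normD.
  exists [seq (a * c.1, c.2) | c <- s].
  by rewrite /F WZ -scalerBr normrZ gtr0_norm.
have pN x : p (- x) = p x.
  suff pNle y : p (- y) <= p y.
    by apply/eqP; rewrite eq_le pNle -{1}(opprK x) pNle.
  apply: lb_le_inf => [|_ [s _ <-]]; first by exists (F [::] y), [::].
  apply: le_trans (pF [seq (-1 * c.1, c.2) | c <- s] _) _.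
  by rewrite /F WZ scaleN1r -opprD normrN.
have p_norm x : p x <= `|x|.
  by have := pF [::] x; rewrite /F /W big_nil subr0.
(* As [p] is the distance to the span, a functional below [p] vanishes on every [u n], and the
   hypothesis on [z] yields [p z = 0]. *)
have [l [_ lp lz]] := seminorm_dominated z pS pN p_norm.
have pz0 : p z = 0.
  rewrite -lz; apply: zl => n; apply/eqP; rewrite -normr_le0.
  apply: le_trans (lp _) _; apply: le_trans (pF [:: (1, n)] _) _.
  by rewrite /F /W big_seq1 /= scale1r subrr normr0.
apply/eqP; rewrite -normr_le0; apply/ler_addgt0Pr => e e0; rewrite add0r.
have e40 : 0 < e / 4 by rewrite divr_gt0.
have [||_ [s _ <-] sz] := @inf_lt _ (range (F^~ z)) (e / 4).
- by exists (F [::] z), [::].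
- by rewrite -/(p z) pz0.
have [s' s'P] := rat_combinations_dense u s e40.
have [g1 gD] := gP (pickle s'); rewrite pickleK /= in gD.
have : `|D s'| <= `|D s' - z|.
  have := dual_space_ub (g (pickle s')) (D s' - z).
  rewrite linearB /= zg subr0 gD normr_id => /le_trans; apply.
  by rewrite ler_piMl.
have := ler_distD (W s) z (D s'); have := ler_normD (z - D s') (D s').
rewrite subrK [`|D s' - z|]distrC.
by move: sz s'P; rewrite /F -/(W s) -/(D s'); lra.
Qed.

Theorem weakly_compact_subsequence (A : set X) u :
  weak_hadamard X A -> (forall n, A (u n)) ->
  exists (f : nat -> nat) x, (forall n, (n <= f n)%N) /\
    (u \o f : nat -> weak X) @ \oo --> (x : weak X).
Proof.
move=> cA uA; have [g gP] := countable_separating u.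
have clusterA v : (forall n, A (v n)) ->
    exists y : X, A y /\ cluster ((v : nat -> weak X) @ \oo) (y : weak X).
  move=> vA; have [|y [Ay cy]] := cA ((v : nat -> weak X) @ \oo) _; last by exists y.
  by exists 0%N => // n _; exact: vA.
have [x [_ cx]] := clusterA u uA.
have /choice[f fP] : forall j, exists n, (j <= n)%N /\
    forall k, (k <= j)%N -> `|g k (u n) - g k x| <= j.+1%:R^-1.
  by move=> j; apply: weak_cluster_seq cx; rewrite invr_gt0.
have cluster0 (phi : nat -> nat) y l :
    cluster ((u \o phi : nat -> weak X) @ \oo) (y : weak X) ->
    (forall n, l (u n) = 0) -> l y = 0.
  move=> cy lu; apply/eqP; rewrite -normr_le0; apply/ler_addgt0Pr => e e0.
  have [n [_]] := weak_cluster_seq1 l 0 e0 cy.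
  by rewrite /= lu sub0r normrN add0r.
exists f, x; split; first by move=> n; have [] := fP n.
apply: contrapT => /weak_seqP nv.
have [l [e [e0 eP]]] : exists l (e : R), 0 < e /\
    forall N, exists n, (N <= n)%N /\ e < `|l (u (f n)) - l x|.
  apply: contrapT => nle; apply: nv => l e e0; apply: contrapT => nN.
  apply: nle; exists l, e; split=> // N; apply: contrapT => nn.
  by apply: nN; exists N => n Nn; rewrite leNgt; apply/negP => en; apply: nn; exists n.
have /choice[phi phiP] := eP.
have [y [_ cy]] := clusterA (u \o (f \o phi)) (fun n => uA _).
suff yx : y = x.
  have [n [_ ]] := weak_cluster_seq1 l 0 e0 cy.
  by rewrite /= yx leNgt; have [_ ->] := phiP n.
apply/eqP; rewrite -subr_eq0; apply/eqP; apply: gP => [k ku|k].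
  by rewrite linearB /= (cluster0 _ _ _ cy ku) (cluster0 id _ _ cx ku) subrr.
rewrite linearB /=; apply/eqP; rewrite -normr_le0; apply/ler_addgt0Pr => a a0.
have a20 : 0 < a / 2 by rewrite divr_gt0.
have [N NP] := invS_small a20.
have [n [Nn]] := weak_cluster_seq1 (g k) (maxn k N) a20 cy.
have [pn _] := phiP n; have [_ /(_ k)gk] := fP (phi n).
move: Nn; rewrite geq_max => /andP[kn Nn] /=.
have := NP _ (leq_trans Nn pn); have := gk (leq_trans kn pn).
rewrite add0r [`|g k (u _) - g k y|]distrC.
move=> A1 A2 A3; apply: le_trans (ler_distD (g k (u (f (phi n)))) _ _) _.
by rewrite [leRHS]splitr lerD// (le_trans A1).
Qed.

Lemma schur_hadamard_weak_hadamard (f : X -> R) x : schur_property X ->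
  differentiable_wrt (hadamard X) f x -> differentiable_wrt (weak_hadamard X) f x.
Proof.
move=> schurX /differentiable_wrtP[L fL]; apply/differentiable_wrtP; exists L.
move=> A wA e e0; apply: contrapT => nd.
have [|t [h thP]] := @vanishing_steps _ _ A
    (fun t h => e * t < `|f (x + t *: h) - f x - t * L h|).
  move=> d d0; apply: contrapT => nth; apply: nd; exists d => // t h td Ah.
  by rewrite leNgt; apply/negP => eth; apply: nth; exists t, h.
have hA n : A (h n) by have [] := thP n.
have [s [y [sn sy]]] := weakly_compact_subsequence wA hA.
(* The subsequence with its norm limit is norm compact, so the Hadamard derivative controls all its
   directions at once. *)
have cK := compact_convergent_seq (schur_weak_limit schurX sy).
have [d d0 dP] := fL _ cK e e0.
have [N NP] := invS_small d0.
have [t0 tN _] := thP (s N); apply/negP; rewrite -leNgt; apply: dP.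
  rewrite t0; apply: lt_le_trans tN _; exact: NP (sn N).
by right; exists N.
Qed.

End eberlein_smulian.

(** * The cycle of implications *)

Theorem theorem3p7 (R : realType) (X : completeNormedModType R)
  (X_infinite_dimensional : infinite_dimensional X) :
  [<->
    schur_property X;

    forall f : dual_space X -> R^o,
      lower_semicontinuous (fun l : weak_star X => (f l)%:E) ->
      continuous f ->
      convex_function [set: dual_space X] f ->
      forall l : dual_space X,
        differentiable_wrt (gateaux (dual_space X)) f l <->
        differentiable_wrt (frechet (dual_space X)) f l;

    forall p : X -> R, equivalent_norm p ->
      forall l : dual_space X,
        differentiable_wrt (gateaux (dual_space X)) (dual_norm p) l <->
        differentiable_wrt (frechet (dual_space X)) (dual_norm p) l;

    forall f : X -> R^o, lipschitz f ->
      forall x : X,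
        differentiable_wrt (hadamard X) f x <->
        differentiable_wrt (weak_hadamard X) f x].
Proof.
tfae.
- move=> schurX f flsc fcont fconv l; split; last exact: frechet_gateaux.
  exact: gateaux_frechet_convex.
- exact: dual_norm_gateaux_frechet.
(* The step from dual norms to Lipschitz functions passes through the Schur property. *)
- move=> GF f _ x; split.
    apply: schur_hadamard_weak_hadamard; apply: gateaux_frechet_dual_norm_schur.
    by move=> p peq l /(GF p peq l).
  exact/differentiable_wrt_sub/compact_weakly_compact.
- move=> HWH; apply: hadamard_lipschitz_schur => f flip x.
  by move=> /(HWH f flip x).
Qed.
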